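(* Let $n_0\ge0$ be an integer, $0<\alpha\le1$, and let $\lambda_{(n)_i}>0$ ($n\ge n_0$, $i\ge1$) satisfy $\sum_{i=1}^{\infty}\lambda_{(n)_i}<\infty$ for all $n\ge n_0$. Let $\{\mathcal{X}_1^{\alpha}(t)\}_{t\ge0}$ be the process whose state probabilities $p_1^{\alpha}(n,t)=\mathrm{Pr}\{\mathcal{X}_1^{\alpha}(t)=n\}$ satisfy $$\frac{\mathrm{d}^{\alpha}}{\mathrm{d}t^{\alpha}}p_1^{\alpha}(n,t)=-\sum_{i=1}^{\infty}\lambda_{(n)_i}p_1^{\alpha}(n,t)+\sum_{i=1}^{n}\lambda_{(n-i)_i}p_1^{\alpha}(n-i,t),\quad n\ge n_0,$$ with $p_1^{\alpha}(n_0,0)=1$ and $p_1^{\alpha}(n,0)=0$ for $n>n_0$. Then $$p_1^{\alpha}(n_0,t)=E_{\alpha,1}\left(-\sum_{i=1}^{\infty}\lambda_{(n_0)_i}t^{\alpha}\right),$$ and for every $m\ge1$ $$p_1^{\alpha}(n_0+m,t)=\sum_{(x_1,\dots,x_m)\in\Theta_m^{m}}\ \prod_{j=0}^{m-1}\lambda_{(n_0+j)_{x_{j+1}}}\ \frac{(-1)^{m^*-1}}{\prod_{l=2}^{m^*}\mu_l}\sum_{i=m^*-1}^{\infty}\frac{(-t^{\alpha})^{i}}{\Gamma(i\alpha+1)}\sum_{(y_1,\dots,y_{m^*})\in\Omega^{i}_{m^*}}\ \prod_{l=1}^{m^*}\mu_l^{y_l},$$ where, for each tuple $(x_1,\dots,x_m)$,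 $m^*=|\Lambda_m|$ and $\mu_l=\sum_{i=1}^{\infty}\lambda_{(n_0+(j)_l)_i}$, $1\le l\le m^*$. If moreover, for each tuple in $\Theta_m^m$, the numbers $\mu_1,\dots,\mu_{m^*}$ are distinct, then $$p_1^{\alpha}(n_0+m,t)=\sum_{(x_1,\dots,x_m)\in\Theta_m^{m}}\ \prod_{j=0}^{m-1}\lambda_{(n_0+j)_{x_{j+1}}}\ \sum_{i=1}^{m^*}\frac{E_{\alpha,1}(-\mu_i t^{\alpha})}{\prod_{l=1,\,l\ne i}^{m^*}(\mu_l-\mu_i)}.$$
   Context: Caputo derivative: for $0<\alpha<1$, $\frac{\mathrm{d}^{\alpha}}{\mathrm{d}t^{\alpha}}f(t)=\frac{1}{\Gamma(1-\alpha)}\int_0^t(t-s)^{-\alpha}f'(s)\,\mathrm{d}s$; for $\alpha=1$ it is $f'(t)$. Mittag-Leffler function: $E_{\alpha,1}(x)=\sum_{j=0}^{\infty}\frac{x^j}{\Gamma(j\alpha+1)}$. Conventions: $p_1^{\alpha}(n,t)=0$ for $n<n_0$, and $\lambda_{(n)_0}=1$ for all $n\ge n_0$. The sets $\Theta_n^k\subset\mathbb{R}^n$ ($n,k\ge1$): let $\bar e_n^{\,j}$ be the $n$-tuple unit row vector with $1$ at the $j$th place and $0$ elsewhere, and for $m>n$ let $Q_{n\times m}=[\,I_{n\times n}\ \ O_{n\times(m-n)}\,]$ (identity block followed by zero block), so that $\bar x\mapsto\bar xQ_{n\times m}$ appends $m-n$ zeros to $\bar x$. For a set $A$ of row vectors,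 $AQ+v=\{\bar xQ+v:\bar x\in A\}$. Then $\Theta_1^k=\{(1)\}$ for all $k\ge1$, and for $n\ge2$ $$\Theta_n^k=\begin{cases}\bigcup_{i=1}^{k}\left\{\Theta_{n-i}^{k}Q_{(n-i)\times n}+i\,\bar e_n^{\,n-i+1}\right\}, & 1\le k\le n-1,\\[1ex]\bigcup_{i=1}^{n-1}\left\{\Theta_{n-i}^{n}Q_{(n-i)\times n}+i\,\bar e_n^{\,n-i+1}\right\}\cup\{n\,\bar e_n^{\,1}\}, & k\ge n.\end{cases}$$ For $(x_1,\dots,x_n)\in\Theta_n^k$, $\Lambda_n=\{0,1,\dots,n\}\setminus\{1\le j\le n-1:\ x_{j+1}=0\}$, $n^*=|\Lambda_n|$, and $(j)_1<(j)_2<\dots<(j)_{n^*}$ are the elements of $\Lambda_n$ in increasing order, i.e. $(j)_1=0$, $(j)_l=\inf\{(j)_{l-1}<j\le n-1:\ x_{j+1}\ne0\}$ for $1<l<n^*$, and $(j)_{n^*}=n$. All of these depend on the tuple. With $\mathbb{N}_0$ the non-negative integers, $$\Omega^{i}_{n}=\Big\{(y_1,\dots,y_n):\ \sum_{j=1}^{n}y_j=i,\ y_1\in\mathbb{N}_0,\ y_j\in\mathbb{N}_0\setminus\{0\}\text{ for }2\le j\le n\Big\}.$$ *)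

(* Defs.v *)
From HB Require Import structures.
From mathcomp Require Import all_boot all_order all_algebra.
From mathcomp Require Import finmap.
From mathcomp Require Import all_classical all_reals all_analysis.
From mathcomp Require Import measurable_realfun.

Set Implicit Arguments.
Unset Strict Implicit.
Unset Printing Implicit Defensive.

Import Order.TTheory GRing.Theory Num.Theory.
Import numFieldNormedType.Exports.

Local Open Scope classical_set_scope.
Local Open Scope ring_scope.

Definition Gamma (R : realType) (z : R) : R :=
  \int[@lebesgue_measure R]_(x in `]0, +oo[) (x `^ (z - 1) * expR (- x)).

(* E_{a,1} *)
Definition mittag_leffler (R : realType) (a x : R) : R :=
  limn (series (fun j : nat => x ^+ j / Gamma (j%:R * a + 1))).

Definition caputo (R : realType) (a : R) (f : R -> R) (t : R) : R :=
  if a == 1 then derive1 f t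
  else (Gamma (1 - a))^-1 *
       \int[@lebesgue_measure R]_(s in `]0, t[) ((t - s) `^ (- a) * derive1 f s).

(* [derive1] and the integral are total functions; this says that the
   derivative and the integral in [caputo a f t] genuinely exist. *)
Definition caputo_derivable (R : realType) (a : R) (f : R -> R) (t : R) : Prop :=
  if a == 1 then derivable f t 1
  else (forall s, 0 < s < t -> derivable f s 1) /\
       (@lebesgue_measure R).-integrable `]0, t[
         (fun s => ((t - s) `^ (- a) * derive1 f s)%:E).

(* X t is extended-real valued so that a trajectory may leave the integers
   (e.g. sit at +oo after an explosion): no [\sum_n p n t = 1] is imposed. *)
Definition state_prob (R : realType) (d : measure_display)
    (T : measurableType d) (P : probability T R) (X : R -> T -> \bar R)
    (n : nat) (t : R) : R :=
  fine (P [set w | X t w = (n%:R)%:E]).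

Definition total_rate (R : realType) (lam : nat -> nat -> R) (n : nat) : R :=
  limn (series (fun i : nat => lam n i.+1)).

(* Coordinates of tuples are numbered from 0 throughout: the j-th coordinate
   x_j of the mathematical text is [nth 0 x j.-1]. *)

(* x Q_{m x n} + i e_n^{m+1}: the default value of [nth] supplies the
   appended zeros. *)
Definition extend (n m i : nat) (x : m.-tuple nat) : n.-tuple nat :=
  [tuple (nth 0 x j + (if j == m :> nat then i else 0))%N | j < n].

(* n e_n^1 *)
Definition single_step (n : nat) : n.-tuple nat :=
  [tuple (if j == 0 :> nat then n else 0)%N | j < n].

(* The recursion is on n; the first argument is fuel, see [Theta1] and
   [ThetaE] for the equations it satisfies. *)
Fixpoint Theta_rec (fuel n k : nat) : {fset n.-tuple nat} :=
  if fuel is fuel'.+1 then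
    if n == 1%N then [fset single_step n]%fset
    else if (k <= n - 1)%N then
      (\big[fsetU/fset0]_(1 <= i < k.+1)
         [fset extend n i x | x in Theta_rec fuel' (n - i) k])%fset
    else
      (\big[fsetU/fset0]_(1 <= i < n)
         [fset extend n i x | x in Theta_rec fuel' (n - i) n]
       `|` [fset single_step n])%fset
  else fset0.

Definition Theta (n k : nat) : {fset n.-tuple nat} := Theta_rec n n k.

Lemma Theta1 (k : nat) : Theta 1 k = [fset [tuple 1%N]]%fset.
Proof.
rewrite /Theta /=; congr [fset _]%fset; apply: val_inj => /=.
by rewrite enum_ordSl enum_ord0.
Qed.

Lemma Theta_rec_fuel (d d' n k : nat) : (0 < n)%N -> (n <= d)%N -> (n <= d')%N ->
  Theta_rec d n k = Theta_rec d' n k.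
Proof.
elim: d d' n k => [|d IH] [|d'] n k n0 nd nd' /=; [by []|..].
- by move: (leq_trans n0 nd).
- by move: (leq_trans n0 nd').
have le_fuel (i e : nat) : (0 < i)%N -> (n <= e.+1)%N -> (n - i <= e)%N.
  by move=> i0 ne; rewrite leq_subLR (leq_trans ne) // -add1n leq_add2r.
case: eqP => // _; case: ifP => kn; last congr (_ `|` _)%fset;
    apply: eq_big_nat => i /andP[i0 ik];
    rewrite (IH d') ?le_fuel // subn_gt0 //.
by rewrite (leq_trans ik) // -(prednK n0) ltnS -subn1.
Qed.

Lemma ThetaE (n k : nat) : (2 <= n)%N ->
  Theta n k =
    if (k <= n - 1)%N then
      (\big[fsetU/fset0]_(1 <= i < k.+1)
         [fset extend n i x | x in Theta (n - i) k])%fset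
    else
      (\big[fsetU/fset0]_(1 <= i < n)
         [fset extend n i x | x in Theta (n - i) n]
       `|` [fset single_step n])%fset.
Proof.
case: n => [//|n] n2; rewrite {1}/Theta /=.
have -> : (n.+1 == 1)%N = false by case: n n2.
have nn (i : nat) : (0 < i)%N -> (n.+1 - i <= n)%N.
  by move=> i0; rewrite leq_subLR -add1n leq_add2r.
case: ifP => kn; last congr (_ `|` _)%fset;
    apply: eq_big_nat => i /andP[i0 ik];
    rewrite (@Theta_rec_fuel n (n.+1 - i)) ?nn // subn_gt0 //.
by rewrite (leq_trans ik) // ltnS (leq_trans kn) // subn1.
Qed.

(* The elements of Lambda_n in increasing order. *)
Definition Lambda (n : nat) (x : n.-tuple nat) : seq nat :=
  [seq j <- iota 0 n.+1 | ~~ [&& 1 <= j, j <= n - 1 & nth 0 x j == 0]%N].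

Definition nstar (n : nat) (x : n.-tuple nat) : nat := size (Lambda x).

(* mu lam n0 x l is the number mu_{l+1}: l also counts from 0. *)
Definition mu (R : realType) (lam : nat -> nat -> R) (n0 n : nat)
    (x : n.-tuple nat) (l : 'I_(nstar x)) : R :=
  total_rate lam (n0 + nth 0 (Lambda x) l)%N.

(* Omega_n^i; since \sum_j y_j = i forces y_j <= i, taking the entries in
   'I_i.+1 loses no tuple and makes the set finite. *)
Definition Omega (n i : nat) : {set n.-tuple 'I_i.+1} :=
  [set y : n.-tuple 'I_i.+1 |
    (\sum_(j < n) tnth y j == i)%N &&
    [forall j : 'I_n, (0 < j)%N ==> (0 < tnth y j)%N]]%SET.

Definition series_term (R : realType) (lam : nat -> nat -> R) (n0 n : nat)
    (x : n.-tuple nat) (a t : R) (i : nat) : R :=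
  (- (t `^ a)) ^+ i / Gamma (i%:R * a + 1) *
  \sum_(y in Omega (nstar x) i)
    \prod_(l < nstar x) mu lam n0 l ^+ tnth y l.

(* Main.v *)
Require Import Defs.
From HB Require Import structures.
From mathcomp Require Import all_boot all_order all_algebra.
From mathcomp Require Import finmap.
From mathcomp Require Import all_classical all_reals all_analysis.
From mathcomp Require Import measurable_realfun.
From mathcomp Require Import ring zify.

(** Write p_m(t) for the probability of the state n0 + m. Since jumps only go
upwards, the equations form a lower triangular linear system
D^alpha p = A p, and the solution is the matrix Mittag-Leffler series

  p(t) = sum over k of (A^k p(0)) t^(k alpha) / Gamma (k alpha + 1).

Analysis. Inverting the Caputo derivative gives the Volterra equation
p_m(t) = p_m(0) + I^alpha (A p)_m(t), where I^alpha is the Riemann-Liouville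
integral ([caputo_volterra]). The inversion rests on Abel's identity
I^alpha I^(1 - alpha) = I^1, a consequence of Tonelli's theorem and of the Beta
integral ([kern_convA], [kern_conv]), and on the fundamental theorem of
calculus for a derivative that exists everywhere and is integrable but not
known to be continuous ([everywhere_derivable_FTC2]). As probabilities are
bounded by 1, substituting the Volterra equation K times into itself leaves
a remainder of at most M^K t^(K alpha) / Gamma (K alpha + 1)
([taylor_remainder]); Gamma (K alpha + 1) outgrows every geometric sequence
([Gamma_ge]), so the series converges to p ([cvg_taylor_series]).

Combinatorics. The coordinate m of A^k p(0) is a sum over the chains of
states from n0 to n0 + m, and the tuples of Theta m m encode these chains
([taylor_Theta]). A chain with exit rates mu_1, ..., mu_n contributes the
product of its jump rates times the complete homogeneous symmetric polynomial
of degree k - n + 1 in - mu_1, ..., - mu_n ([chain_coef]). Up to the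
prefactor of the statement, the sum over Omega is this polynomial, by
expansion of a product of geometric series ([Omega_chain_coef]); for distinct
rates, partial fractions turn it into a combination of the powers
(- mu_i)^k, whose series are Mittag-Leffler functions
([chain_coef_distinct]). *)

Set Implicit Arguments.
Unset Strict Implicit.
Unset Printing Implicit Defensive.

Import Order.TTheory GRing.Theory Num.Theory.
Import numFieldNormedType.Exports.

Local Open Scope classical_set_scope.
Local Open Scope ring_scope.

(** * The Gamma and Beta integrals *)

Section GammaBeta.
Context {R : realType}.
Notation mu := (@lebesgue_measure R).
Implicit Types (a b c t x : R).

(** By uniqueness of Lebesgue measure on half-open intervals, it is c times
its image under s |-> c s + x. *)
Lemma ge0_integral_affine (f : R -> \bar R) c x : 0 < c ->
  measurable_fun setT f -> (forall s, (0 <= f s)%E) ->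
  (\int[mu]_s f s = c%:E * \int[mu]_s f (c * s + x)%R)%E.
Proof.
move=> c0 mf f0.
pose phi : measurableTypeR R -> measurableTypeR R := fun s => c * s + x.
have mphi0 : measurable_fun [set: R] (fun s : R => c * s + x).
  by apply: measurable_funD => //; apply: measurable_funM.
have mphi : measurable_fun setT phi := mphi0.
pose phi' : {mfun measurableTypeR R >-> measurableTypeR R} :=
  HB.pack phi (isMeasurableFun.Build _ _ _ _ phi mphi).
pose c' : {nonneg R} := NngNum (ltW c0).
have mscaleE (A : set (measurableTypeR R)) : measurable A ->
    mu A = mscale c' (pushforward mu phi') A.
  apply: lebesgue_measure_unique => _ [[u v]] _ <-.
  change (mu `]u, v]%classic = c%:E * mu (phi @^-1` `]u, v]%classic))%E.
  have -> : phi @^-1` `]u, v] = `](u - x) / c, (v - x) / c]%classic.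
    by apply/seteqP; split => s /=; rewrite !in_itv /= /phi
      ltr_pdivrMr// ler_pdivlMr// ltrBlDr lerBrDr mulrC.
  rewrite !lebesgue_measure_itv/= !lte_fin ltr_pM2r ?invr_gt0// ltrD2r.
  case: ifP => uv; last by rewrite mule0.
  by rewrite -EFinD -EFinM -mulrBl mulrCA divff ?gt_eqF// mulr1 opprB addrA subrK.
have -> : (\int[mu]_s f (c * s + x)%R =
    \int[mu]_(s in phi @^-1` [set: R]) (f \o phi) s)%E by rewrite preimage_setT.
rewrite -(ge0_integral_pushforward mphi)//.
rewrite -(@ge0_integral_mscale _ _ _ _ _ _ c')//.
by apply: eq_measure_integral => A mA _; exact: mscaleE.
Qed.


(** The kernel of the Riemann-Liouville integral of order a, up to the factor
1 / Gamma a. Its extension by 0 turns integrals over ]0, t[ into convolutions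
on the line; the test is needed because powR is 1 at negative bases. *)
Definition kern a x : R := if 0 < x then x `^ (a - 1) else 0.

Lemma kern_ge0 a x : 0 <= kern a x.
Proof. by rewrite /kern; case: ifP => // _; exact: powR_ge0. Qed.

Lemma kern_patch a : kern a = (fun x => x `^ (a - 1)) \_ `]0, +oo[.
Proof.
apply/funext => x; rewrite /kern patchE.
case: ifPn => x0; first by rewrite mem_set//= in_itv /= x0.
by rewrite memNset//= in_itv /= (negbTE x0).
Qed.

Lemma measurable_kern a : measurable_fun setT (kern a).
Proof.
rewrite kern_patch; apply/(measurable_restrictT _ _).1 => //.
by apply: measurable_funTS; exact: measurable_powR.
Qed.

Lemma kernZ a c x : 0 < c -> kern a (c * x) = c `^ (a - 1) * kern a x.
Proof.
move=> c0; rewrite /kern pmulr_rgt0//; case: ifPn => x0; last by rewrite mulr0.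
by rewrite powRM// ltW.
Qed.

(** Gamma is the real part of this extended integral, hence would be 0 if it
diverged; the Beta identity is therefore proved for the extended integral
first. *)
Definition eGamma a : \bar R := (\int[mu]_s (kern a s * expR (- s))%:E)%E.

Lemma eGammaE a :
  eGamma a = (\int[mu]_(s in `]0%R, +oo[) (s `^ (a - 1) * expR (- s))%:E)%E.
Proof.
rewrite /eGamma [RHS]integral_mkcond; apply: eq_integral => s _.
rewrite patchE /kern; case: ifPn => s0.
  by rewrite mem_set//= in_itv /= s0.
by rewrite memNset//= ?mul0r// in_itv /= (negbTE s0).
Qed.

Lemma GammaE a : Gamma a = fine (eGamma a).
Proof. by rewrite eGammaE. Qed.

Lemma continuous_powR_pos a x : 0 < x -> {for x, continuous (fun s : R => s `^ a)}.
Proof.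
move=> x0; apply: differentiable_continuous; apply/derivable1_diffP.
by apply: derivable_powR; rewrite in_itv /= x0.
Qed.

Lemma measurable_gamma_integrand a :
  measurable_fun [set: R] (fun s => kern a s * expR (- s)).
Proof.
apply: measurable_funM; first exact: measurable_kern.
by apply: measurableT_comp => //; apply: measurableT_comp.
Qed.

(** The antiderivative x^a / a is available on [1 / (n + 2), 1], and monotone
convergence exhausts ]0, 1]. *)
Lemma integral_powR_01 a : 0 < a ->
  (\int[mu]_(s in `]0%R, 1%R]) (s `^ (a - 1))%:E <= (a^-1)%:E)%E.
Proof.
move=> a0.
pose F (n : nat) := `[(n.+2%:R)^-1, 1 : R]%classic.
have F0 (n : nat) x : F n x -> 0 < x.
  rewrite /F /= in_itv /= => /andP[+ _]; exact: lt_le_trans.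
have -> : `]0, 1]%classic = \bigcup_n F n.
  apply/seteqP; split => x /=.
    rewrite in_itv /= => /andP[x0 x1].
    have [n _ nx] := near_infty_natSinv_lt (PosNum x0).
    exists n => //; rewrite /F /= in_itv /= x1 andbT.
    by apply/ltW/(nx n.+1); rewrite /= leqnSn.
  by move=> [n _ Fx]; rewrite in_itv /= (F0 n)//=; move: Fx; rewrite /F /= in_itv => /andP[].
have ndF : nondecreasing_seq F.
  move=> m n mn; apply/subsetPset => x; rewrite /F /= !in_itv /= => /andP[mx ->].
  by rewrite andbT (le_trans _ mx)// lef_pV2 ?posrE// ler_nat.
have mF n : measurable (F n) by exact: measurable_itv.
have mf n : measurable_fun (F n) (fun s : R => (s `^ (a - 1))%:E).
  by apply/measurable_EFinP/measurable_funTS; exact: measurable_powR.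
have f0 n x : F n x -> (0 <= (x `^ (a - 1))%:E)%E.
  by move=> _; rewrite lee_fin powR_ge0.
have /cvg_lim <- // : (\int[mu]_(s in F n) (s `^ (a - 1))%:E)%E @[n --> \oo] -->
    (\int[mu]_(s in \bigcup_n F n) (s `^ (a - 1))%:E)%E.
  exact: ge0_nondecreasing_set_cvg_integral.
apply: lime_le.
  apply: ereal_nondecreasing_is_cvgn.
  exact: ge0_nondecreasing_set_nondecreasing_integral.
apply: nearW => n.
have cF x : 0 < x -> {for x, continuous (fun s : R => s `^ a / a)}.
  move=> x0; apply: cvgM; last exact: cvg_cst.
  exact: continuous_powR_pos.
rewrite /F (@continuous_FTC2 _ _ (fun s => s `^ a / a)).
- rewrite powR1 -EFinD lee_fin mul1r gerBl.
  by rewrite divr_ge0// ?powR_ge0// ltW.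
- by rewrite invf_lt1// ltr1n.
- apply: continuous_in_subspaceT => x /set_mem /(F0 n) x0.
  exact: continuous_powR_pos.
- split.
  + move=> x; rewrite in_itv /= => /andP[x0 _].
    by apply: derivableM => //; apply: derivable_powR; rewrite in_itv /= andbT (lt_trans _ x0).
  + by apply/cvg_at_right_filter/cF; rewrite invr_gt0.
  + by apply/cvg_at_left_filter/cF.
- move=> x; rewrite in_itv /= => /andP[x0 _].
  have {}x0 : 0 < x by rewrite (lt_trans _ x0).
  rewrite derive1Mr; last by apply: derivable_powR; rewrite in_itv /= andbT.
  by rewrite powR_derive1 ?in_itv /= ?andbT// mulrAC divff ?gt_eqF// mul1r.
Qed.


Lemma eGamma_ge0 a : (0 <= eGamma a)%E.
Proof.
by apply: integral_ge0 => s _; rewrite lee_fin mulr_ge0 ?kern_ge0 ?expR_ge0.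
Qed.

(** The inequality y <= exp y at y = x / (2 (N + 1)), raised to the power N +
1. *)
Lemma expn_le_expR (N : nat) x : 0 <= x ->
  x ^+ N.+1 <= (2 * N.+1%:R) ^+ N.+1 * expR (x / 2).
Proof.
move=> x0.
have -> : expR (x / 2) = expR (x / (2 * N.+1%:R)) ^+ N.+1.
  by rewrite -expRM_natr invfM mulrA mulrVK// unitfE.
rewrite -exprMn lerXn2r// ?nnegrE ?mulr_ge0 ?expR_ge0//.
rewrite mulrC -ler_pdivrMr ?mulr_gt0//.
by apply: le_trans (expR_ge1Dx _); rewrite lerDr.
Qed.

(** On ]0, 1] the integrand is at most s^(a - 1); beyond 1 it is at most a
multiple of exp (- s / 2), hence of an exponential density. *)
Lemma eGamma_lty a : 0 < a -> (eGamma a < +oo)%E.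
Proof.
move=> a0.
pose g1 := (fun s => s `^ (a - 1)) \_ `]0, 1].
have mg1 : measurable_fun setT g1.
  apply/(measurable_restrictT _ _).1 => //.
  by apply: measurable_funTS; exact: measurable_powR.
have g10 s : 0 <= g1 s by rewrite /g1 patchE; case: ifP => // _; exact: powR_ge0.
have [N Na] : exists N : nat, a <= N.+1%:R.
  by exists (Num.truncn a); rewrite ltW// truncnS_gt.
pose C : R := 2 * (2 * N.+1%:R) ^+ N.+1.
have C0 : 0 <= C by rewrite mulr_ge0// exprn_ge0.
pose g2 := exponential_pdf (2^-1 : R).
have g20 s : 0 <= g2 s by rewrite exponential_pdf_ge0.
have mg2 : measurable_fun setT g2 by exact: measurable_exponential_pdf.
have bound s : kern a s * expR (- s) <= g1 s + C * g2 s.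
  rewrite /kern; case: ifPn => s0; last by rewrite mul0r addr_ge0 ?mulr_ge0.
  have [s1|s1] := leP s 1.
    rewrite ler_wpDr ?mulr_ge0// /g1 patchE mem_set/= ?in_itv /= ?s0//.
    rewrite ler_piMr ?powR_ge0// -expR0 ler_expR oppr_le0 ltW//.
  rewrite ler_wpDl// /g2 exponential_pdfE ?(ltW s0)// /C.
  rewrite mulrACA divff// mul1r.
  apply: (@le_trans _ _ (s ^+ N.+1 * expR (- s))).
    rewrite ler_wpM2r ?expR_ge0// -powR_mulrn ?(ltW s0)// ler_powR ?(ltW s1)//.
    by rewrite lerBlDr (le_trans Na)// lerDl.
  have -> : expR (- 2^-1 * s) = expR (s / 2) * expR (- s).
    by rewrite -expRD; congr expR; rewrite {3}[s]splitr; field.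
  by rewrite mulrCA mulrA ler_wpM2r ?expR_ge0// mulrC expn_le_expR// ltW.
apply: (@le_lt_trans _ _ (\int[mu]_s ((g1 s)%:E + (C * g2 s)%:E))%E).
  apply: ge0_le_integral => //.
  - by move=> s _; rewrite lee_fin mulr_ge0 ?kern_ge0 ?expR_ge0.
  - by apply/measurable_EFinP; exact: measurable_gamma_integrand.
  - apply/measurable_EFinP; apply: measurable_funD => //.
    by apply: measurable_funM.
  - by move=> s _; rewrite -EFinD lee_fin.
rewrite ge0_integralD//; last 4 first.
- by move=> s _; rewrite lee_fin.
- by apply/measurable_EFinP.
- by move=> s _; rewrite lee_fin mulr_ge0.
- by apply/measurable_EFinP; apply: measurable_funM.
rewrite lte_add_pinfty//.
  apply: le_lt_trans (ltry a^-1).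
  apply: le_trans (integral_powR_01 a0).
  rewrite [leRHS]integral_mkcond le_eqVlt; apply/orP; left; apply/eqP.
  by apply: eq_integral => s _; rewrite /g1 !patchE; case: ifP.
under eq_integral do rewrite EFinM.
rewrite ge0_integralZl//; last 2 first.
- by apply/measurable_EFinP.
- by move=> s _; rewrite lee_fin.
by rewrite integral_exponential_pdf// mule1 ltry.
Qed.

Lemma eGamma_fin_num a : 0 < a -> eGamma a \is a fin_num.
Proof. by move=> a0; rewrite ge0_fin_numE ?eGamma_ge0// eGamma_lty. Qed.

Lemma EFin_Gamma a : 0 < a -> (Gamma a)%:E = eGamma a.
Proof. by move=> a0; rewrite GammaE fineK// eGamma_fin_num. Qed.

Lemma integral_exponential_pdf_shift (r B : R) : 0 < r ->
  (\int[mu]_s (exponential_pdf r (s - B))%:E = 1)%E.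
Proof.
move=> r0; rewrite -(integral_exponential_pdf r0).
have mf : measurable_fun [set: R] (fun s => (exponential_pdf r s)%:E).
  by apply/measurable_EFinP; exact: measurable_exponential_pdf.
rewrite [RHS](@ge0_integral_affine _ 1 (- B))// ?mul1e.
  by apply: eq_integral => s _; rewrite mul1r.
by move=> s; rewrite lee_fin exponential_pdf_ge0// ltW.
Qed.

(** A shifted exponential density has total mass 1, so any c for which c times
such a density fits below the integrand is a lower bound of Gamma a. *)
Lemma Gamma_ge_exp a (r B c : R) : 0 < a -> 0 < r -> 0 < B -> 0 <= c ->
  (forall s, B <= s -> c * exponential_pdf r (s - B) <= s `^ (a - 1) * expR (- s)) ->
  c <= Gamma a.
Proof.
move=> a0 r0 B0 c0 cle; rewrite -lee_fin EFin_Gamma//.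
have mf : measurable_fun [set: R] (fun s => (exponential_pdf r (s - B))%:E).
  apply/measurable_EFinP; apply: measurableT_comp.
    exact: measurable_exponential_pdf.
  by apply: measurable_funB.
have pge0 s : 0 <= exponential_pdf r s by rewrite exponential_pdf_ge0// ltW.
rewrite -[leLHS]mule1 -(integral_exponential_pdf_shift B r0) -ge0_integralZl//; last first.
  by move=> s _; rewrite lee_fin.
apply: ge0_le_integral => //.
- by move=> s _; rewrite mule_ge0// lee_fin.
- exact: measurable_funeM.
- by apply/measurable_EFinP; exact: measurable_gamma_integrand.
move=> s _; rewrite -EFinM lee_fin.
have [Bs|sB] := leP B s.
  by rewrite /kern (lt_le_trans B0 Bs) cle.
by rewrite lt0_exponential_pdf ?subr_lt0// mulr0 mulr_ge0 ?kern_ge0 ?expR_ge0.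
Qed.

Lemma Gamma_gt0 a : 0 < a -> 0 < Gamma a.
Proof.
move=> a0; apply: (@lt_le_trans _ _ (expR (- 2) / 2)).
  by rewrite divr_gt0 ?expR_gt0.
apply: (@Gamma_ge_exp a 2 1 _ a0) => // s s1.
rewrite exponential_pdfE ?subr_ge0//.
rewrite mulrA -(mulrA (expR _)) mulVf// mulr1 -expRD.
have s0 : 0 < s by rewrite (lt_le_trans _ s1).
have -> : - 2 + - 2 * (s - 1) = - s + - s by ring.
rewrite expRD ler_wpM2r ?expR_ge0//.
apply: (@le_trans _ _ (s `^ (- 1))).
  rewrite powRN powRr1 ?(ltW s0)// expRN lef_pV2 ?posrE ?expR_gt0//.
  by apply: le_trans (expR_ge1Dx s); rewrite lerDr.
by rewrite ler_powR// lerDr ltW.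
Qed.

(** The integrand restricted to [B, +oo[ already has at least this mass. As B is free,
Gamma (k a + 1) outgrows every geometric sequence in k. *)
Lemma Gamma_ge a (B : R) : 0 <= a -> 0 < B -> B `^ a * expR (- B) <= Gamma (a + 1).
Proof.
move=> a0 B0; apply: (@Gamma_ge_exp _ 1 B) => //.
- by rewrite ltr_wpDl.
- by rewrite mulr_ge0 ?powR_ge0 ?expR_ge0.
move=> s sB; rewrite exponential_pdfE ?subr_ge0// addrK mul1r mulN1r opprB.
rewrite -mulrA -expRD addrA [- B + B]addrC subrr add0r ler_wpM2r ?expR_ge0//.
by rewrite ge0_ler_powR// ?nnegrE// ?(ltW B0)// (le_trans (ltW B0)).
Qed.

Lemma Gamma1 : Gamma (1 : R) = 1.
Proof.
apply: EFin_inj; rewrite EFin_Gamma// eGammaE.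
rewrite integral_itv_obnd_cbnd; last first.
  apply/measurable_EFinP/measurable_funTS.
  apply: measurable_funM; first exact: measurable_powR.
  by apply: measurableT_comp => //; apply: measurableT_comp.
rewrite -(@integral_exponential_pdf R 1)// integral_mkcond.
apply: eq_integral => s _; rewrite patchE /exponential_pdf patchE.
by case: ifP => // _; rewrite subrr powRr0 !mul1r mulN1r.
Qed.


(** Euler's Beta integral, as the convolution of two kernels at time 1. *)
Definition ebeta a b : \bar R := (\int[mu]_s (kern a (1 - s) * kern b s)%:E)%E.

Lemma measurable_kern_conv a b t :
  measurable_fun [set: R] (fun s => kern a (t - s) * kern b s).
Proof.
apply: measurable_funM; last exact: measurable_kern.
apply: measurableT_comp; first exact: measurable_kern.
by apply: measurable_funB.
Qed.

(** Homogeneity: substitute t s for s. *)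
Lemma kern_conv_ebeta a b t : 0 < t ->
  (\int[mu]_s (kern a (t - s) * kern b s)%:E =
   (kern (a + b) t)%:E * ebeta a b)%E.
Proof.
move=> t0; have f0 (r s : R) : (0 <= (kern a (r - s) * kern b s)%:E)%E.
  by rewrite lee_fin mulr_ge0 ?kern_ge0.
rewrite (@ge0_integral_affine _ t 0); last 3 first.
- exact: t0.
- by apply/measurable_EFinP; exact: measurable_kern_conv.
- exact: f0.
rewrite -ge0_integralZl_EFin//; last 2 first.
- apply/measurable_EFinP; apply: measurableT_comp (measurable_kern_conv a b t) _.
  by apply: measurable_funD => //; apply: measurable_funM.
- exact: ltW.
rewrite /ebeta -[RHS]ge0_integralZl_EFin; last 4 first.
- exact: measurableT.
- by move=> s _.
- by apply/measurable_EFinP; exact: measurable_kern_conv.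
- exact: kern_ge0.
apply: eq_integral => s _; rewrite addr0 -!EFinM; congr (_%:E).
rewrite -[X in X - _]mulr1 -mulrBr !kernZ// mulrACA !mulrA; congr (_ * _ * _).
rewrite /kern t0 -[X in X * _ * _](powRr1 (ltW t0)) -!powRD ?(gt_eqF t0) ?implybT//.
by congr (_ `^ _); ring.
Qed.

Lemma kern_conv_le0 a b t : t <= 0 -> forall s, kern a (t - s) * kern b s = 0.
Proof.
move=> t0 s; rewrite /kern; case: (ltP 0 s) => s0; last by rewrite mulr0.
by rewrite subr_gt0 ltNge (le_trans t0 (ltW s0)) /= mul0r.
Qed.

(** Both sides are the total mass of the convolution of the integrands of
Gamma a and Gamma b: Tonelli gives the left one, and extracting exp (- x) from
the convolution at x gives the right one. *)
Lemma eGamma_ebeta a b : (eGamma a * eGamma b = ebeta a b * eGamma (a + b))%E.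
Proof.
pose g c (s : R) : R := kern c s * expR (- s).
have mg c : measurable_fun setT (g c) by exact: measurable_gamma_integrand.
have g0 c s : 0 <= g c s by rewrite mulr_ge0 ?kern_ge0 ?expR_ge0.
pose F (z : R * R) : \bar R := (g a (z.1 - z.2) * g b z.2)%:E.
have mF : measurable_fun setT F.
  apply/measurable_EFinP; apply: measurable_funM.
    by apply: measurableT_comp => //; apply: measurable_funB.
  exact: measurableT_comp.
have F0 z : (0 <= F z)%E by rewrite lee_fin mulr_ge0.
transitivity (\int[mu]_x \int[mu]_y F (x, y))%E.
  rewrite fubini_tonelli//.
  transitivity (\int[mu]_y ((g b y)%:E * eGamma a))%E.
    rewrite [RHS]ge0_integralZr; last 4 first.
    - exact: measurableT.
    - by apply/measurable_EFinP; exact: mg.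
    - by move=> x _; rewrite lee_fin; exact: g0.
    - exact: eGamma_ge0.
    exact: muleC.
  apply: eq_integral => y _; rewrite /eGamma -ge0_integralZl_EFin; last 4 first.
  - exact: measurableT.
  - by move=> x _; rewrite lee_fin; exact: g0.
  - by apply/measurable_EFinP; exact: mg.
  - exact: g0.
  rewrite [RHS](@ge0_integral_affine _ 1 y)// ?mul1e; last first.
    apply/measurable_EFinP; apply: measurable_funM => /=; last exact: measurable_cst.
    apply: measurableT_comp; first exact: mg.
    by apply: measurable_funB => //; exact: measurable_cst.
  by apply: eq_integral => x _; rewrite /F /= mul1r addrK -EFinM mulrC.
transitivity (\int[mu]_x (ebeta a b * (g (a + b) x)%:E))%E; last first.
  rewrite ge0_integralZl//.
  - by apply/measurable_EFinP; exact: mg.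
  - by move=> x _; rewrite lee_fin; exact: g0.
  - by apply: integral_ge0 => s _; rewrite lee_fin mulr_ge0 ?kern_ge0.
apply: eq_integral => x _.
have -> : (\int[mu]_y F (x, y) =
    (expR (- x))%:E * \int[mu]_y (kern a (x - y) * kern b y)%:E)%E.
  rewrite -ge0_integralZl_EFin ?expR_ge0//; last 2 first.
  - by move=> s _; rewrite lee_fin mulr_ge0 ?kern_ge0.
  - by apply/measurable_EFinP; exact: measurable_kern_conv.
  apply: eq_integral => y _; rewrite /F /g /= -EFinM; congr (_%:E).
  by rewrite mulrACA -expRD opprB addrAC subrr add0r mulrC.
rewrite /g; have [x0|x0] := ltP 0 x; last first.
  rewrite integral0_eq; last by move=> s _; rewrite kern_conv_le0.
  by rewrite mule0 /kern ltNge x0 /= mul0r mule0.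
by rewrite kern_conv_ebeta// muleA -EFinM muleC mulrC.
Qed.

Lemma ebetaE a b : 0 < a -> 0 < b ->
  ebeta a b = (Gamma a * Gamma b / Gamma (a + b))%:E.
Proof.
move=> a0 b0; have ab0 : 0 < a + b by rewrite addr_gt0.
have := eGamma_ebeta a b; rewrite -!EFin_Gamma// => E.
have B0 : (0 <= ebeta a b)%E.
  by apply: integral_ge0 => s _; rewrite lee_fin mulr_ge0 ?kern_ge0.
have := Gamma_gt0 ab0; move: E; move: (Gamma (a + b)) => G.
case: (ebeta a b) B0 => [r _ | _ | //].
  by rewrite -!EFinM => -[->] G0; rewrite mulfK// gt_eqF.
by move=> + G0; rewrite mulyr gtr0_sg// mul1e.
Qed.

Lemma kern_conv a b t : 0 < a -> 0 < b ->
  (\int[mu]_s (kern a (t - s) * kern b s)%:E =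
   (kern (a + b) t * (Gamma a * Gamma b / Gamma (a + b)))%:E)%E.
Proof.
move=> a0 b0; have [t0|t0] := ltP 0 t.
  by rewrite kern_conv_ebeta// ebetaE.
rewrite integral0_eq; last by move=> s _; rewrite kern_conv_le0.
by rewrite /kern ltNge t0 /= mul0r.
Qed.

(** Associativity of convolution: after Tonelli, the inner integral is a
translate of the convolution of the two kernels. This is the semigroup law of
Riemann-Liouville integrals on nonnegative functions. *)
Lemma kern_convA (phi : R -> R) a b t : 0 < a -> 0 < b ->
  measurable_fun setT phi -> (forall s, 0 <= phi s) ->
  (\int[mu]_s ((kern a (t - s))%:E * \int[mu]_r (kern b (s - r) * phi r)%:E) =
   (Gamma a * Gamma b / Gamma (a + b))%:E *
     \int[mu]_r (kern (a + b) (t - r) * phi r)%:E)%E.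
Proof.
move=> a0 b0 mphi phi0.
pose F (z : R * R) : \bar R := (kern a (t - z.1) * (kern b (z.1 - z.2) * phi z.2))%:E.
have mF : measurable_fun setT F.
  apply/measurable_EFinP; apply: measurable_funM.
    by apply: measurableT_comp; [exact: measurable_kern|apply: measurable_funB].
  apply: measurable_funM; last exact: measurableT_comp.
  by apply: measurableT_comp; [exact: measurable_kern|apply: measurable_funB].
have F0 z : (0 <= F z)%E by rewrite lee_fin !mulr_ge0 ?kern_ge0.
transitivity (\int[mu]_x \int[mu]_y F (x, y))%E.
  apply: eq_integral => s _; rewrite -ge0_integralZl_EFin ?kern_ge0//; last 2 first.
  - by move=> r _; rewrite lee_fin mulr_ge0 ?kern_ge0.
  - apply/measurable_EFinP; apply: measurable_funM => //.
    by apply: measurableT_comp; [exact: measurable_kern|apply: measurable_funB].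
rewrite fubini_tonelli// -ge0_integralZl_EFin//; last 3 first.
- by move=> r _; rewrite lee_fin mulr_ge0 ?kern_ge0.
- apply/measurable_EFinP; apply: measurable_funM => //.
  by apply: measurableT_comp; [exact: measurable_kern|apply: measurable_funB].
- by rewrite divr_ge0 ?mulr_ge0 ?ltW ?Gamma_gt0 ?addr_gt0.
apply: eq_integral => r _.
rewrite -EFinM mulrA [X in (X * _)%:E]mulrC EFinM -kern_conv// muleC.
rewrite -ge0_integralZl_EFin//; last 2 first.
- by move=> s _; rewrite lee_fin mulr_ge0 ?kern_ge0.
- by apply/measurable_EFinP; exact: measurable_kern_conv.
rewrite [RHS](@ge0_integral_affine _ 1 (- r))// ?mul1e; last 2 first.
- by apply: measurable_funeM; apply/measurable_EFinP; exact: measurable_kern_conv.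
- by move=> x; rewrite mule_ge0// lee_fin// mulr_ge0 ?kern_ge0.
apply: eq_integral => s _; rewrite /F /= mul1r -EFinM; congr (_%:E).
by rewrite mulrA mulrC opprB addrA subrK.
Qed.

End GammaBeta.

(** * Integrals of derivatives that exist everywhere *)

Section EverywhereFTC.
Context {R : realType}.
Notation mu := (@lebesgue_measure R).
Implicit Types (a b c x y : R).

(** A bound on the difference quotient at x holds on a whole neighbourhood of
x, on both sides; A is carried along so that one radius serves both purposes.
*)
Lemma local_slope (f : R -> R) x c (A : set R) : derivable f x 1 ->
  derive1 f x < c -> nbhs x A ->
  exists2 e : R, 0 < e & forall y, `|y - x| < e ->
    [/\ A y, x <= y -> f y - f x <= c * (y - x)
      & y <= x -> f x - f y <= c * (x - y)].
Proof.
move=> df fc nA.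
have df' : h^-1 *: (f (h + x) - f x) @[h --> 0^'] --> derive1 f x.
  have : cvg (h^-1 *: (f (h + x) - f x) @[h --> 0^']).
    move: df; rewrite /derivable.
    set g1 := fun h : R => _; set g2 := fun h : R => _.
    by have -> : g1 = g2 by apply/funext => h; rewrite /g1 /g2 /= [h%:A]mulr1.
  exact.
have : \forall t \near 0^', t^-1 *: (f (t + x) - f x) < c by exact: cvgr_lt fc.
rewrite near_withinE near_simpl => /nbhs_ballP[e1 /= e10 H1].
have /nbhs_ballP[e2 /= e20 H2] := nA.
exists (Num.min e1 e2); first by rewrite lt_min e10 e20.
move=> y; rewrite lt_min => /andP[ye1 ye2].
have slope : y != x -> (y - x)^-1 * (f y - f x) < c.
  rewrite -subr_eq0 => yx; have := H1 (y - x).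
  rewrite /ball /= sub0r normrN => /(_ ye1 yx).
  by rewrite subrK.
split.
- by apply: H2; rewrite /ball /= distrC.
- rewrite le_eqVlt => /predU1P[->|xy]; first by rewrite !subrr mulr0.
  have := slope (negbT (gt_eqF xy)).
  by rewrite mulrC ltr_pdivrMr ?subr_gt0// => /ltW.
- rewrite le_eqVlt => /predU1P[->|xy]; first by rewrite !subrr mulr0.
  have := slope (negbT (lt_eqF xy)).
  rewrite -[in f y - f x]opprB -[in (y - x)^-1]opprB invrN mulrNN.
  by rewrite mulrC ltr_pdivrMr ?subr_gt0// => /ltW.
Qed.

(** A form of the Vitali-Caratheodory theorem: h lies below a function u of
almost the same integral that, near each point, exceeds a constant larger than
h at that point. Each slice n ep <= h < (n + 1) ep is enclosed in an open set
of almost the same measure, and u is the sum of (n + 1) ep over these open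
sets. *)
Lemma vitali_caratheodory (h : R -> R) a b e : 0 < e -> a <= b ->
  measurable_fun `]a, b[ h -> (forall x, x \in `]a, b[ -> 0 <= h x) ->
  exists u : R -> \bar R, [/\ measurable_fun setT u, forall x, (0 <= u x)%E,
    (\int[mu]_(x in `]a, b[) u x <= \int[mu]_(x in `]a, b[) (h x)%:E + e%:E)%E &
    forall x, x \in `]a, b[ -> exists c,
      [/\ 0 <= c, h x < c & \forall y \near x, (c%:E <= u y)%E]].
Proof.
move=> e0 ab mh h0; set D := `]a, b[%classic.
have mD : measurable D by exact: measurable_itv.
(* Slices of height ep cost ep (b - a), the open sets another ep: e in all. *)
pose ep := e / (b - a + 1).
have ba1 : 0 < b - a + 1 by rewrite ltr_wpDl// subr_ge0.
have ep0 : 0 < ep by rewrite divr_gt0.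
pose E (n : nat) := D `&` h @^-1` `[n%:R * ep, n.+1%:R * ep[.
have mE n : measurable (E n) by apply: mh => //; exact: measurable_itv.
have muE n : (mu (E n) < +oo)%E.
  apply: (@le_lt_trans _ _ (mu D)).
    by apply: le_outer_measure; exact: subIsetl.
  by rewrite lebesgue_measure_itv /=; case: ifP => _; rewrite ?ltry.
(* An excess measure of del n at height (n + 1) ep costs ep / 2^(n + 1). *)
pose del (n : nat) : R := (n.+1%:R * (2 ^ n.+1)%:R)^-1.
have del0 n : 0 < del n by rewrite invr_gt0 mulr_gt0// ltr0n expn_gt0.
have /choice[V HV] n : exists V : set R,
    [/\ open V, E n `<=` V & (mu (V `\` E n) < (del n)%:E)%E].
  by have [] := lebesgue_regularity_outer (mE n) (muE n) (del0 n) => V HV; exists V.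
have mV n : measurable (V n) by apply: open_measurable; case: (HV n).
pose u (x : R) : \bar R := (\sum_(n <oo) (n.+1%:R * ep * \1_(V n) x)%:E)%E.
have c0 n : 0 <= n.+1%:R * ep by rewrite mulr_ge0// ltW.
have t0 n x : (0 <= (n.+1%:R * ep * \1_(V n) x)%:E)%E.
  by rewrite lee_fin mulr_ge0.
have mt n : measurable_fun setT (fun x : R => (n.+1%:R * ep * \1_(V n) x)%:E).
  by apply/measurable_EFinP; apply: measurable_funM.
have mi n : measurable_fun setT (\1_(V n) : R -> R) by exact: measurable_indic.
exists u; split.
- by apply: ge0_emeasurable_sum.
- by move=> x; apply: nneseries_ge0.
- have mtD n : measurable_fun D (fun x : R => (n.+1%:R * ep * \1_(V n) x)%:E).
    exact: measurable_funTS.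
  rewrite /u integral_nneseries//.
  pose A (n : nat) : \bar R := ((n.+1%:R * ep)%:E * mu (E n))%E.
  apply: (@le_trans _ _ (\sum_(n <oo) (A n + (ep / (2 ^ n.+1)%:R)%:E))%E).
    apply: lee_nneseries => [n _ _|n _]; first exact: integral_ge0.
    under eq_integral do rewrite EFinM.
    rewrite ge0_integralZl_EFin//; last first.
      by apply/measurable_EFinP; exact: measurable_funTS (mi n).
    rewrite integral_indic//; last exact: mV.
    have -> : (ep / (2 ^ n.+1)%:R)%:E = ((n.+1%:R * ep)%:E * (del n)%:E)%E.
      rewrite -EFinM /del invfM; congr (_%:E).
      by rewrite mulrACA divff ?mul1r// mulr1.
    rewrite /A -ge0_muleDr ?measure_ge0 ?lee_fin ?(ltW (del0 n))//.
    apply: lee_wpmul2l; first by rewrite lee_fin.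
    have [_ EV /ltW muV] := HV n.
    apply: (@le_trans _ _ (mu (V n))).
      by apply: le_outer_measure; exact: subIsetl.
    rewrite -[X in (mu X <= _)%E](setDUK EV).
    have /le_trans : (mu (E n `|` V n `\` E n) <= mu (E n) + mu (V n `\` E n))%E.
      by apply: measureU2; [exact: mE|apply: measurableD; [exact: mV|exact: mE]].
    by apply; rewrite leeD2l.
  apply: le_trans (epsilon_trick _ _ (ltW ep0)) _.
    by move=> n; rewrite mule_ge0// lee_fin.
  have DE : D = \bigcup_n E n.
    apply/seteqP; split => [x Dx|x [n _ []]//].
    exists (Num.truncn (h x / ep)) => //; split => //=.
    rewrite in_itv /= -ler_pdivlMr// -ltr_pdivrMr// truncn_le ?truncnS_gt ?andbT//.
    by rewrite divr_ge0 ?(ltW ep0)// h0.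
  have tE : trivIset setT E.
    apply/trivIsetP => m n _ _ mn; rewrite -subset0 => x [[_ /=]].
    rewrite !in_itv /= => /andP[m1 m2] [_ /=]; rewrite in_itv /= => /andP[n1 n2].
    have mn1 : (m < n.+1)%N.
      by rewrite -(ltr_nat R) -(ltr_pM2r ep0); exact: le_lt_trans m1 n2.
    have nm1 : (n < m.+1)%N.
      by rewrite -(ltr_nat R) -(ltr_pM2r ep0); exact: le_lt_trans n1 m2.
    by move: mn; rewrite eqn_leq -ltnS mn1 -ltnS nm1.
  have mhe : measurable_fun D (fun x => (h x + ep)%:E).
    by apply/measurable_EFinP; apply: measurable_funD.
  have : (\sum_(n <oo) A n <= \int[mu]_(x in D) (h x + ep)%:E)%E.
    rewrite [in leRHS]DE ge0_integral_bigcup//; last 2 first.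
    + by rewrite -DE.
    + by rewrite -DE => x Dx; rewrite lee_fin addr_ge0 ?(ltW ep0)// h0.
    apply: lee_nneseries => [n _ _|n _]; first by rewrite mule_ge0// lee_fin.
    rewrite /A -(integral_cst mu (mE n)); apply: ge0_le_integral => //.
    + exact: mE.
    + by move=> x _; rewrite lee_fin.
    + by apply: (measurable_funS mD) => //; exact: subIsetl.
    move=> x [_ /=]; rewrite in_itv /= => /andP[nx _].
    by rewrite lee_fin -natr1 mulrDl mul1r lerD2r.
  move=> /(leeD2r ep%:E)/le_trans; apply.
  under eq_integral do rewrite EFinD.
  rewrite ge0_integralD//; last 2 first.
  + by apply/measurable_EFinP; exact: mh.
  + by move=> x _; rewrite lee_fin ltW.
  rewrite integral_cst// -addeA leeD2l//.
  rewrite /= lebesgue_measure_itv /= lte_fin.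
  case: ifP => abb; last first.
    rewrite mule0 add0e lee_fin /ep ler_pdivrMr// ler_peMr ?(ltW e0)//.
    by rewrite lerDr subr_ge0.
  change (ep%:E * (b - a)%:E + ep%:E <= e%:E)%E.
  rewrite -EFinM -EFinD lee_fin -[X in _ + X]mulr1 -mulrDr.
  by rewrite /ep divfK ?gt_eqF.
- move=> x Dx; pose n := Num.truncn (h x / ep).
  have Ex : E n x.
    split => //=.
    rewrite in_itv /= -ler_pdivlMr// -ltr_pdivrMr// truncn_le ?truncnS_gt ?andbT//.
    by rewrite divr_ge0 ?(ltW ep0)// h0.
  exists (n.+1%:R * ep); split => //.
    by case: Ex => _ /=; rewrite in_itv /= => /andP[].
  have [oV EV _] := HV n.
  have : nbhs x (V n) by apply: open_nbhs_nbhs; split => //; exact: EV.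
  apply: filterS => y Vy.
  apply: le_trans (nneseries_lim_ge n.+1 _); last by [].
  rewrite big_nat_recr//= indicE mem_set// mulr1.
  by rewrite leeDr// sume_ge0.
Qed.


(** The set of x in [c, d] such that f x - f c is at most the integral of u
over [c, x[ contains its supremum z, and goes beyond z unless z = d: on both
sides of z the increments of f are at most those of a line whose slope is
locally below u. *)
Lemma increment_le_integral_inner (f : R -> R) (u : R -> \bar R) a b :
  measurable_fun setT u -> (forall x, (0 <= u x)%E) ->
  (forall x, x \in `]a, b[ -> derivable f x 1) ->
  (forall x, x \in `]a, b[ -> exists c,
     [/\ 0 <= c, derive1 f x < c & \forall y \near x, (c%:E <= u y)%E]) ->
  forall c d, a < c -> c <= d -> d < b ->
    ((f d - f c)%:E <= \int[mu]_(x in `]a, b[) u x)%E.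
Proof.
move=> mu0 u0 df hu c d ac cd db.
pose I (x y : R) := (\int[mu]_(z in `[x, y[) u z)%E.
have IU (x y z : R) : x <= y -> y <= z -> I x z = (I x y + I y z)%E.
  move=> xy yz; rewrite /I (@itv_bndbnd_setU _ _ (BLeft x) (BLeft y)) ?bnd_simp//.
  rewrite ge0_integral_setU//; first exact: measurable_funTS.
  apply/disj_setPS => w [] /=; rewrite !in_itv /= => /andP[_ wy] /andP[yw _].
  by move: (lt_le_trans wy yw); rewrite ltxx.
have Ic (k x y e z : R) : 0 <= k -> x <= y -> `|x - z| < e -> `|y - z| < e ->
    (forall w, `|w - z| < e -> (k%:E <= u w)%E) -> ((k * (y - x))%:E <= I x y)%E.
  move=> k0 xy xe ye ku.
  apply: (@le_trans _ _ (\int[mu]_(z in `[x, y[) cst k%:E z)%E); last first.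
    apply: ge0_le_integral => //; first exact: measurable_funTS.
    move=> w /=; rewrite in_itv /= => /andP[xw wy]; apply: ku.
    move: xe ye; rewrite !ltr_norml => /andP[x1 x2] /andP[y1 y2].
    by rewrite (lt_le_trans x1) ?lerD2r//= (lt_trans _ y2)// ltrD2r.
  rewrite integral_cst; last exact: measurable_itv.
  rewrite /= lebesgue_measure_itv /= lte_fin.
  by move: xy; rewrite le_eqVlt => /predU1P[->|->]; rewrite ?ltxx ?mule0 ?subrr ?mulr0.
apply: (@le_trans _ _ (I c d)); last first.
  apply: ge0_subset_integral => //; first exact: measurable_funTS.
  move=> x /=; rewrite !in_itv /= => /andP[cx xd].
  by rewrite (lt_le_trans ac cx) (lt_trans xd db).
pose S := [set x | c <= x <= d /\ ((f x - f c)%:E <= I c x)%E].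
have Sc : S c.
  by split; [rewrite lexx cd|rewrite subrr integral_ge0].
have ubS : ubound S d by move=> x [/andP[]].
have supS : has_sup S by split; [exists c|exists d].
set z := sup S.
have cz : c <= z by apply: sup_upper_bound.
have zd : z <= d by apply: ge_sup => //; exists c.
have zab : z \in `]a, b[ by rewrite in_itv /= (lt_le_trans ac cz) (le_lt_trans zd db).
have [k [k0 fk ku]] := hu z zab.
have [e e0 He] := local_slope (df z zab) fk ku.
have ke w : `|w - z| < e -> (k%:E <= u w)%E by move=> /He[].
have zz : `|z - z| < e by rewrite subrr normr0.
have Sz : S z.
  have [y Sy zy] := sup_adherent e0 supS.
  have yz : y <= z by apply: sup_upper_bound.
  case: Sy => /andP[cy yd] fy.
  have yze : `|y - z| < e by rewrite distrC ger0_norm ?subr_ge0// ltrBlDr -ltrBlDl.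
  split; first by rewrite cz zd.
  rewrite (IU _ y)// addeC.
  have -> : f z - f c = (f z - f y) + (f y - f c) by rewrite addrA subrK.
  rewrite EFinD; apply: leeD => //.
  apply: le_trans (Ic k y z e z k0 yz yze zz ke).
  by rewrite lee_fin; have [_ _] := He y yze; exact.
have [zd'|dz] := ltP z d; last first.
  have -> : d = z by apply/eqP; rewrite eq_le zd dz.
  by case: Sz.
(* A point y of S beyond z contradicts the choice of z as a supremum. *)
pose y := Num.min d (z + e / 2).
have zy : z < y by rewrite lt_min zd' ltrDl divr_gt0.
have yze : `|y - z| < e.
  rewrite ger0_norm ?subr_ge0 ?ltW// ltrBlDl.
  have : y <= z + e / 2 by rewrite /y ge_min lexx orbT.
  by move/le_lt_trans; apply; rewrite ltrD2l ltr_pdivrMr// ltr_pMr// ltr1n.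
have : S y.
  split; first by rewrite (le_trans cz (ltW zy))/= ge_min lexx.
  rewrite (IU _ z) ?(ltW zy)//.
  have -> : f y - f c = (f z - f c) + (f y - f z) by ring.
  rewrite EFinD; apply: leeD; first by case: Sz.
  apply: le_trans (Ic k z y e z k0 (ltW zy) zz yze ke).
  by rewrite lee_fin; have [_ + _] := He y yze; apply; exact: ltW.
move/(sup_upper_bound supS); rewrite -/z => yz.
by move: (lt_le_trans zy yz); rewrite ltxx.
Qed.

(** A weak bound h on the derivative suffices, since the function u of
vitali_caratheodory exceeds h strictly and locally; the endpoints are reached
by continuity of f. *)
Lemma increment_le_integral (f h : R -> R) a b : a < b ->
  {within `[a, b], continuous f} ->
  (forall x, x \in `]a, b[ -> derivable f x 1) ->
  measurable_fun `]a, b[ h ->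
  (forall x, x \in `]a, b[ -> 0 <= h x /\ derive1 f x <= h x) ->
  ((f b - f a)%:E <= \int[mu]_(x in `]a, b[) (h x)%:E)%E.
Proof.
move=> ab cf df mh h0.
apply/lee_addgt0Pr => e e0.
have [u [mu0 u0 Iu hu]] := vitali_caratheodory e0 (ltW ab) mh (fun x xab => (h0 x xab).1).
apply: le_trans Iu.
have hu' x : x \in `]a, b[ -> exists c,
    [/\ 0 <= c, derive1 f x < c & \forall y \near x, (c%:E <= u y)%E].
  move=> xab; have [c [c0 hc uc]] := hu x xab; exists c; split => //.
  by apply: le_lt_trans hc; case: (h0 x xab).
have inner := increment_le_integral_inner mu0 u0 df hu'.
have I0 : (0 <= \int[mu]_(x in `]a, b[) u x)%E by apply: integral_ge0.
move: inner I0; case: (integral _ _ _) => [r inner _|_ _|//]; last by rewrite leey.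
have /continuous_within_itvP [] // := cf => _ fa fb.
have step d : a < d -> d < b -> f d - f a <= r.
  move=> ad db.
  have cv : (f d - f x) @[x --> a^'+] --> f d - f a by apply: cvgB => //; exact: cvg_cst.
  rewrite -(cvg_lim _ cv)//; apply: limr_le; first by apply/cvg_ex; eexists; exact: cv.
  near=> x; have := inner x d; rewrite lee_fin; apply => //.
  by near: x; exact: nbhs_right_le.
have cv : (f x - f a) @[x --> b^'-] --> f b - f a by apply: cvgB => //; exact: cvg_cst.
rewrite lee_fin -(cvg_lim _ cv)//; apply: limr_le; first by apply/cvg_ex; eexists; exact: cv.
near=> x; apply: step => //.
Unshelve. all: end_near. Qed.

Lemma integrable_cst_oo a b c : mu.-integrable `]a, b[ (cst c%:E).
Proof.
apply/integrableP; split; first exact: measurable_cst.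
rewrite (eq_integral (cst `|c|%:E))// integral_cst; last exact: measurable_itv.
by rewrite /= lebesgue_measure_itv /=; case: ifP => _; rewrite ?mule0// -EFinM ltry.
Qed.

(** Truncating the derivative at - n and adding n x to f gives a nonnegative
bound; dominated convergence then removes the truncation. *)
Lemma increment_le_integral_derive (f : R -> R) a b : a < b ->
  {within `[a, b], continuous f} ->
  (forall x, x \in `]a, b[ -> derivable f x 1) ->
  mu.-integrable `]a, b[ (fun x => (derive1 f x)%:E) ->
  ((f b - f a)%:E <= \int[mu]_(x in `]a, b[) (derive1 f x)%:E)%E.
Proof.
move=> ab cf df idf.
have mdf : measurable_fun `]a, b[ (derive1 f).
  by apply/measurable_EFinP; exact: measurable_int idf.
pose hN (n : nat) x := Num.max (derive1 f x) (- n%:R).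
have mhN n : measurable_fun `]a, b[ (hN n) by apply: measurable_maxr.
have idf' : mu.-integrable `]a, b[ (fun x => `|(derive1 f x)%:E|%E).
  exact: integrable_abse.
have bnd n x : (`|(hN n x)%:E| <= `|(derive1 f x)%:E|)%E.
  rewrite !abse_EFin lee_fin /hN; case: (leP (- n%:R) (derive1 f x)) => // h.
  by rewrite normrN normr_nat ler_normr; apply/orP; right; rewrite lerNr ltW.
have ihN n : mu.-integrable `]a, b[ (fun x => (hN n x)%:E).
  have mhn : measurable_fun `]a, b[ (fun x => (hN n x)%:E).
    by apply/measurable_EFinP; exact: mhN.
  by apply: (le_integrable _ _ _ idf) => [//||x _]; [exact: mhn|exact: bnd].
have cvI : (\int[mu]_(x in `]a, b[) (hN n x)%:E)%E @[n --> \oo] -->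
    (\int[mu]_(x in `]a, b[) (derive1 f x)%:E)%E.
  have [] // := @dominated_convergence _ _ _ mu `]a, b[%classic _ (fun n x => (hN n x)%:E)
    (fun x => (derive1 f x)%:E) (fun x => `|(derive1 f x)%:E|%E).
  - by move=> n; apply/measurable_EFinP; exact: mhN.
  - by apply/measurable_EFinP; exact: mdf.
  - apply: aeW => x _; apply: cvg_near_cst; near=> n.
    rewrite /hN; congr (_%:E); apply/max_idPl.
    by rewrite lerNl ltW//; near: n; exact: nbhs_infty_gtr.
  - by apply: aeW => x n _; exact: bnd.
rewrite -(cvg_lim _ cvI)//; apply: lime_ge; first by apply/cvg_ex; eexists; exact: cvI.
apply: nearW => n /=.
pose g x := f x + n%:R * x.
have dg x : x \in `]a, b[ -> derivable g x 1 /\ derive1 g x = derive1 f x + n%:R.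
  move=> xab; have fx := df x xab.
  have dl : is_derive x 1 (fun y : R => n%:R *: y) (n%:R *: 1) by exact: is_deriveZ.
  have df' : is_derive x 1 f ('D_1 f x) by exact: derivableP.
  have dg' : is_derive x 1 g ('D_1 f x + n%:R *: 1) by exact: is_deriveD.
  by split; [exact: ex_derive|rewrite !derive1E derive_val [_ *: _]mulr1].
have := @increment_le_integral g (fun x => hN n x + n%:R) a b ab.
have -> : g b - g a = f b - f a + n%:R * (b - a) by rewrite /g; ring.
have -> : (\int[mu]_(x in `]a, b[) (hN n x + n%:R)%:E =
    \int[mu]_(x in `]a, b[) (hN n x)%:E + (n%:R * (b - a))%:E)%E.
  under eq_integral do rewrite EFinD.
  have icn : mu.-integrable `]a, b[ (cst n%:R%:E).
    exact: integrable_cst_oo.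
  rewrite integralD// integral_cst; last exact: measurable_itv.
  by rewrite /= lebesgue_measure_itv /= lte_fin ab.
rewrite EFinD leeD2rE//; apply.
- have cn : continuous (fun x : R => n%:R * x).
    by move=> x; apply: cvgM; [exact: cvg_cst|exact: cvg_id].
  by move=> x; apply: cvgD; [exact: cf|exact: (continuous_subspaceT cn)].
- by move=> x /dg[].
- by apply: measurable_funD => //; exact: mhN.
- move=> x xab; rewrite (dg x xab).2 lerD2r /hN le_max lexx; split => //.
  by rewrite -lerBlDr sub0r le_max lexx orbT.
Unshelve. all: end_near. Qed.

(** Apply the inequality for increments to f and to - f. *)
Theorem everywhere_derivable_FTC2 (f : R -> R) a b : a < b ->
  {within `[a, b], continuous f} ->
  (forall x, x \in `]a, b[ -> derivable f x 1) ->
  mu.-integrable `]a, b[ (fun x => (derive1 f x)%:E) ->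
  (\int[mu]_(x in `]a, b[) (derive1 f x)%:E = (f b - f a)%:E)%E.
Proof.
move=> ab cf df idf; apply/eqP; rewrite eq_le; apply/andP; split; last first.
  exact: increment_le_integral_derive.
have dN x : x \in `]a, b[ -> derive1 (fun y => - f y) x = - derive1 f x.
  by move=> xab; rewrite derive1N//; exact: df.
rewrite -leeN2 -EFinN opprB -integralN; last exact: integrable_add_def.
have -> : (\int[mu]_(x in `]a, b[) - (derive1 f x)%:E =
   \int[mu]_(x in `]a, b[) (derive1 (fun y => - f y) x)%:E)%E.
  by apply: eq_integral => x /set_mem xab; rewrite dN.
have -> : f a - f b = - f b - - f a by rewrite opprK addrC.
apply: (@increment_le_integral_derive (fun y => - f y) a b ab).
- by move=> x; apply: cvgN; exact: cf.
- by move=> x xab; apply: derivableN; exact: df.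
- apply: (eq_integrable _ _ _ _ (integrableN idf)) => // x /set_mem xab /=.
  by rewrite dN.
Qed.

End EverywhereFTC.

(** * Symmetric polynomials of the exit rates *)

Section ChainCoefficients.
Context {R : realType}.
Implicit Types (a b M : R) (s : seq R) (k : nat).

(** For n = size s, this is (-1)^(k - n + 1) times the complete homogeneous
symmetric polynomial of degree k - n + 1 in the entries of s, and 0 if k < n -
1. The recursion is the one obeyed by the k-th coefficient along a chain of
states whose exit rates are listed from the last state to the first. *)
Fixpoint chain_coef k s : R :=
  if s is b :: s' then
    if k is k'.+1 then chain_coef k' s' - b * chain_coef k' s
    else (s' == [::])%:R
  else 0.

Lemma chain_coef_nil k : chain_coef k [::] = 0.
Proof. by case: k. Qed.

Lemma chain_coef0 b s : chain_coef 0 (b :: s) = (s == [::])%:R.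
Proof. by []. Qed.

Lemma chain_coefS k b s :
  chain_coef k.+1 (b :: s) = chain_coef k s - b * chain_coef k (b :: s).
Proof. by []. Qed.

Lemma chain_coef1 k a : chain_coef k [:: a] = (- a) ^+ k.
Proof.
elim: k => [|k IH]; first by rewrite expr0.
by rewrite /= chain_coef_nil sub0r -/(chain_coef k [:: a]) IH -mulNr exprS.
Qed.

Lemma chain_coef_small k s : (k.+1 < size s)%N -> chain_coef k s = 0.
Proof.
elim: k s => [|k IH] [|b s] //=; first by case: s.
rewrite !ltnS => ks; rewrite -/(chain_coef k (b :: s)) !IH ?mulr0 ?subr0//=.
exact: ltnW.
Qed.

Lemma chain_coef_bound M k s : 0 <= M -> {in s, forall b, `|b| + 1 <= M} ->
  `|chain_coef k s| <= M ^+ k.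
Proof.
move=> M0; elim: k s => [|k IH] [|b s] sM; rewrite ?chain_coef_nil ?normr0 ?exprn_ge0 ?expr0//=.
  by rewrite normr_nat; case: (s == [::]).
rewrite -/(chain_coef k (b :: s)) (le_trans (ler_normB _ _))// normrM.
have sM' : {in s, forall b, `|b| + 1 <= M}.
  by move=> c cs; apply: sM; rewrite inE cs orbT.
apply: (@le_trans _ _ (M ^+ k + `|b| * M ^+ k)).
  by apply: lerD; [exact: IH|apply: ler_wpM2l => //; exact: IH].
rewrite exprS addrC -[X in _ + X]mul1r -mulrDl ler_wpM2r ?exprn_ge0//.
by apply: sM; rewrite inE eqxx.
Qed.

(** Up to sign, the derivative at a of the monic polynomial with simple roots
s. *)
Definition vdm s a : R := \prod_(l <- s | l != a) (l - a).

(** The factor b - a cancels the one that b adds to the denominator, and kills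
the term a = b. *)
Lemma big_vdm_cons (f : R -> R) b s : uniq (b :: s) ->
  \sum_(a <- b :: s) f a * (b - a) / vdm (b :: s) a = \sum_(a <- s) f a / vdm s a.
Proof.
move=> /= /andP[bs _]; rewrite big_cons subrr mulr0 mul0r add0r.
apply: eq_big_seq => a as_; rewrite /vdm big_cons.
have ba : b != a by apply: contraNneq bs => ->.
by rewrite ba invfM mulrA mulfK// subr_eq0.
Qed.

(** Multiplied by b - c = (b - a) - (c - a), the sum over b, c and s becomes
the difference of the sums over c, s and over b, s, which agree by induction.
*)
Lemma sum_inv_vdm s : uniq s ->
  \sum_(a <- s) (vdm s a)^-1 = (size s == 1)%:R.
Proof.
have [n] := ubnP (size s); elim: n s => // n IH [|b [|c s]] sn us.
- by rewrite big_nil.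
- by rewrite big_seq1 /vdm big_cons eqxx big_nil invr1.
apply: (@mulfI _ (b - c)); first by move: us; rewrite /= inE negb_or subr_eq0 => /andP[/andP[]].
rewrite mulr0 big_distrr /=.
transitivity (\sum_(a <- b :: c :: s) 1 * (b - a) / vdm (b :: c :: s) a -
              \sum_(a <- c :: b :: s) 1 * (c - a) / vdm (c :: b :: s) a).
  have pcb : perm_eq (c :: b :: s) (b :: c :: s).
    by rewrite -[c :: b :: s]/([:: c; b] ++ s) -[b :: c :: s]/([:: b; c] ++ s)
       perm_cat2r perm_sym; apply/permP => p /=; rewrite addnCA.
  rewrite [X in _ = _ - X](perm_big _ pcb) /= -sumrB; apply: eq_bigr => a _.
  have -> : vdm (c :: b :: s) a = vdm (b :: c :: s) a by exact: perm_big.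
  by rewrite !mul1r -mulrBl opprB addrA subrK.
have ucb : uniq (c :: b :: s).
  by move: us; rewrite /= !inE !negb_or eq_sym => /and3P[/andP[-> ->] -> ->].
rewrite !big_vdm_cons//.
under eq_bigr do rewrite mul1r.
under [X in _ - X]eq_bigr do rewrite mul1r.
have ub : uniq (b :: s) by case/andP: ucb.
have uc : uniq (c :: s) by case/andP: us.
by rewrite !IH ?subrr.
Qed.

(** The partial fraction sum obeys the recursion of chain_coef by
big_vdm_cons, and starts at the same value by sum_inv_vdm. *)
Lemma chain_coef_distinct k s : uniq s ->
  chain_coef k s = \sum_(a <- s) (- a) ^+ k / vdm s a.
Proof.
elim: k s => [|k IH] [|b s] us; rewrite ?big_nil ?chain_coef_nil//.
  under eq_bigr do rewrite expr0 mul1r.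
  by rewrite sum_inv_vdm//=; case: s {us}.
rewrite /= -/(chain_coef k (b :: s)) !IH//; last by case/andP: us.
rewrite -(big_vdm_cons (fun a => (- a) ^+ k) us) big_distrr /= -sumrB.
apply: eq_bigr => a _.
by rewrite exprS; move: (_ ^+ k) (_^-1) => e w; ring.
Qed.

(** The geometric series of ratio b X truncated at degree N, without its
constant term unless b is the first rate: only the first exponent of a tuple
of Omega may vanish. *)
Definition geo (N : nat) b (first : bool) : {poly R} :=
  \sum_(k < N.+1) (b ^+ k *+ (first || (0 < k)%N)) *: 'X^k.

Fixpoint geo_prod N s : {poly R} :=
  if s is b :: s' then geo N b (s' == [::]) * geo_prod N s' else 1.

(** The product of all entries but the last, that is of all rates but that of
the initial state. *)
Fixpoint tail_prod s : R :=
  if s is b :: s' then (if s' is [::] then 1 else b * tail_prod s') else 1.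

Lemma coef_geo N b first i : (geo N b first)`_i =
  if (i <= N)%N then b ^+ i *+ (first || (0 < i)%N) else 0.
Proof.
rewrite /geo coef_sum; under eq_bigr do rewrite coefZ coefXn.
case: (leqP i N) => iN.
  rewrite (bigD1 (inord i))//= inordK ?ltnS// eqxx mulr1 big1 ?addr0// => j.
  rewrite -val_eqE /= inordK ?ltnS// => ji.
  by rewrite eq_sym (negbTE ji) mulr0.
rewrite big1// => j _; case: eqP => [ij|_]; last by rewrite mulr0.
by move: iN; rewrite ij ltnNge -ltnS ltn_ord.
Qed.

(** The identity (1 - b X) (b X + b^2 X^2 + ...) = b X, with the error of the
truncation. *)
Lemma geo_rec N b : geo N b false = b *: 'X + b *: ('X * geo N b false) - b ^+ N.+1 *: 'X^(N.+1).
Proof.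
apply/polyP => i; rewrite coefB coefD !coefZ coefX coefXM coefXn !coef_geo /=.
case: i => [|[|i]] /=.
- by rewrite mulr0n !mulr0 addr0 subr0.
- case: N => [|N] /=; last by rewrite mulr1n mulr1 mulr0n !(mulr0, addr0, subr0).
  by rewrite mulr0n mulr0 addr0 expr1 subrr.
rewrite mulr0 add0r eqSS !mulr1n.
case: (ltngtP i.+1 N) => iN.
- by rewrite mulr0 subr0 -exprS.
- by rewrite !mulr0 subrr.
- by rewrite mulr1 -exprS iN subrr.
Qed.

(** Up to degree N the truncation error of geo_rec is invisible, so the
coefficients of the product obey the recursion of chain_coef up to signs and
the factor tail_prod. *)
Lemma geo_prod_coef N s i : s != [::] -> (i <= N)%N ->
  (-1) ^+ i * (geo_prod N s)`_i = (-1) ^+ (size s).-1 * tail_prod s * chain_coef i s.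
Proof.
elim: s i => // b [_|c s IH] i _ iN.
  rewrite /= mulr1 coef_geo iN /= mulr1n chain_coef1 expr0 !mul1r.
  by rewrite -exprMn mulN1r.
set s' := c :: s in IH *.
have -> : geo_prod N (b :: s') = geo N b false * geo_prod N s' by [].
elim: i iN => [_|i IHi iN].
  by rewrite /= coef0M coef_geo /= mulr0n mul0r !mulr0.
have {1}-> : geo N b false * geo_prod N s' = b *: ('X * geo_prod N s') +
    b *: ('X * (geo N b false * geo_prod N s')) -
    b ^+ N.+1 *: ('X^(N.+1) * geo_prod N s').
  by rewrite {1}geo_rec mulrBl mulrDl -!scalerAl !mulrA.
have cX (p : {poly R}) : ('X * p)`_i.+1 = p`_i by rewrite coefXM.
rewrite coefB coefD !coefZ !cX coefXnM ltnS iN mulr0 subr0.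
have := IHi (ltnW iN); have := IH i isT (ltnW iN).
rewrite chain_coefS.
have -> : tail_prod (b :: s') = b * tail_prod s' by [].
have -> : (size (b :: s')).-1 = (size s).+1 by [].
have -> : (size s').-1 = size s by [].
move: (chain_coef i s') (chain_coef i (b :: s')) => x y.
move: (geo_prod N s')`_i (geo N b false * geo_prod N s')`_i (tail_prod s') => z w r.
rewrite !exprS; move: ((-1) ^+ i) ((-1) ^+ (size s)) => e e' H1 H2.
have -> : -1 * e * (b * z + b * w) = - b * (e * z) - b * (e * w) by ring.
by rewrite H1 H2; ring.
Qed.

Lemma geo_prod_ord N s :
  geo_prod N s = \prod_(l < size s) geo N (nth 0 (rev s) l) (l == 0%N :> nat).
Proof.
elim: s => [|b s IH] /=; first by rewrite big_ord0.
rewrite big_ord_recr /= mulrC IH; congr (_ * _).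
  apply: eq_bigr => l _; rewrite rev_cons nth_rcons size_rev ltn_ord.
  by [].
by rewrite rev_cons nth_rcons size_rev ltnn eqxx size_eq0.
Qed.

Lemma tail_prod_ord s :
  tail_prod s = \prod_(l < size s | (0 < l)%N) nth 0 (rev s) l.
Proof.
elim: s => [|b s IH] /=; first by rewrite big_ord0.
rewrite big_mkcond big_ord_recr /= rev_cons nth_rcons size_rev ltnn eqxx.
rewrite mulrC.
have -> : \prod_(i < size s) (if (0 < i)%N then nth 0 (rcons (rev s) b) i else 1) = tail_prod s.
  rewrite IH [RHS]big_mkcond; apply: eq_bigr => l _.
  by rewrite nth_rcons size_rev ltn_ord.
by case: s {IH} => //=; rewrite mulr1.
Qed.

(** Expanding the product over all exponent tuples, the coefficient of degree
N keeps the tuples of sum N with positive exponents off the first place. *)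
Lemma Omega_sum n N (v : 'I_n -> R) :
  \sum_(y in Omega n N) \prod_(l < n) v l ^+ tnth y l =
  (\prod_(l < n) geo N (v l) (l == 0%N :> nat))`_N.
Proof.
rewrite /geo bigA_distr_bigA /= coef_sum.
have prodE (f : {ffun 'I_n -> 'I_N.+1}) :
    \prod_(l < n) ((v l ^+ f l *+ ((l == 0%N :> nat) || (0 < f l)%N)) *: 'X^(f l)) =
    (\prod_(l < n) (v l ^+ f l *+ ((l == 0%N :> nat) || (0 < f l)%N))) *: 'X^(\sum_(l < n) f l)
    :> {poly R}.
  rewrite -mul_polyC rmorph_prod -prodrXr -big_split /=.
  by apply: eq_bigr => l _; rewrite mul_polyC.
under [RHS]eq_bigr do rewrite prodE coefZ coefXn.
pose h (f : {ffun 'I_n -> 'I_N.+1}) : n.-tuple 'I_N.+1 := [tuple f l | l < n].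
pose h' (y : n.-tuple 'I_N.+1) : {ffun 'I_n -> 'I_N.+1} := [ffun l => tnth y l].
have hK : cancel h h' by move=> f; apply/ffunP => l; rewrite ffunE tnth_mktuple.
have h'K : cancel h' h.
  by move=> y; apply: eq_from_tnth => l; rewrite tnth_mktuple ffunE.
rewrite big_mkcond (reindex h) /=; last by exists h' => ? _; [exact: hK|exact: h'K].
apply: eq_bigr => f _; rewrite inE.
under eq_bigr do rewrite tnth_mktuple.
have -> : (\sum_(j < n) tnth (h f) j = \sum_(l < n) f l)%N.
  by apply: eq_bigr => l _; rewrite tnth_mktuple.
rewrite [N == _]eq_sym; case: eqP => _ /=; last by rewrite mulr0.
rewrite mulr1.
case: ifPn => [/forallP H|].
  apply: eq_bigr => l _; have := H l; rewrite tnth_mktuple.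
  by rewrite eqn0Ngt; case: (0 < l)%N => //= ->.
rewrite negb_forall => /existsP[l]; rewrite negb_imply tnth_mktuple => /andP[l0 fl].
by rewrite (bigD1 l)//= (negbTE fl) gtn_eqF//= mulr0n mul0r.
Qed.


Lemma Omega_chain_coef n N (s : seq R) (v : 'I_n -> R) : size s = n -> s != [::] ->
  (forall l, v l = nth 0 (rev s) l) -> all (fun b => b != 0) s ->
  (-1) ^+ (n - 1) / (\prod_(l < n | (0 < l)%N) v l) *
   ((-1) ^+ N * \sum_(y in Omega n N) \prod_(l < n) v l ^+ tnth y l) =
  chain_coef N s.
Proof.
move=> sn; subst n => s0 vE s_neq0; rewrite Omega_sum.
under eq_bigr do rewrite vE.
have -> : \prod_(l < size s) geo N (v l) (l == 0%N :> nat) = geo_prod N s.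
  by rewrite geo_prod_ord; apply: eq_bigr => l _; rewrite vE.
rewrite geo_prod_coef// -tail_prod_ord subn1.
have tp0 : tail_prod s != 0.
  rewrite tail_prod_ord; apply/prodf_neq0 => l _.
  by apply: (allP s_neq0); rewrite -mem_rev mem_nth// size_rev.
by rewrite mulrA mulrACA mulVf// mulr1 -exprD addnn -mul2n exprM sqrrN !expr1n mul1r.
Qed.

End ChainCoefficients.

(** * Tuples of Theta as chains of states *)

Lemma nth_mktuple n (f : 'I_n -> nat) j (jn : (j < n)%N) :
  nth 0%N [tuple f l | l < n] j = f (Ordinal jn).
Proof. by rewrite -[j]/(val (Ordinal jn)) -tnth_nth tnth_mktuple. Qed.

Lemma nth_extend n m i (x : m.-tuple nat) j : (m < n)%N -> i != 0%N ->
  nth 0%N (extend n i x) j = (nth 0 x j + (if j == m then i else 0))%N.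
Proof.
move=> mn i0; case: (ltnP j n) => jn; first by rewrite nth_mktuple.
rewrite !nth_default ?size_tuple//; last exact: leq_trans (ltnW mn) jn.
by rewrite gtn_eqF// (leq_trans mn jn).
Qed.

Lemma nth_single n j : nth 0%N (single_step n) j = (if j == 0 then n else 0)%N.
Proof.
case: (ltnP j n) => jn; first by rewrite nth_mktuple.
rewrite nth_default ?size_tuple//; case: eqP jn => // ->.
by rewrite leqn0 => /eqP.
Qed.

(** The extended tuple has a new nonzero entry at n - i, already the last
element of Lambda x, followed by zeros only; the sole new element is n. *)
Lemma Lambda_extend n i (x : (n - i).-tuple nat) : (0 < i < n)%N ->
  Lambda (extend n i x) = rcons (Lambda x) n.
Proof.
move=> /andP[i0 ilt].
set m := (n - i)%N in x *.
have m0 : (0 < m)%N by rewrite subn_gt0.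
have mn : (m < n)%N by rewrite ltn_subrL i0 (leq_trans _ ilt).
have nE : n.+1 = (m.+1 + i)%N by rewrite addSn subnK// ltnW.
have := fun j => @nth_extend n m i x j mn (lt0n_neq0 i0).
move: (extend n i x) => z nz.
rewrite /Lambda nE iotaD filter_cat -cats1 add0n; congr (_ ++ _).
  apply: eq_in_filter => j; rewrite mem_iota /= add0n ltnS => jm.
  rewrite nz; congr (~~ _).
  case: (posnP j) => //= j0.
  case: (ltngtP j m) jm => // [jm _|-> _].
    rewrite addn0.
    have -> : (j <= n - 1)%N by lia.
    by have -> : (j <= m - 1)%N by lia.
  rewrite addn_eq0 [i == 0%N]gtn_eqF// !andbF.
  by rewrite subn1 leqNgt prednK// leqnn.
have -> : i = (i.-1 + 1)%N by rewrite addn1 prednK.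
rewrite iotaD filter_cat.
have -> : (m.+1 + i.-1 = n)%N by rewrite addSnnS prednK// subnK// ltnW.
rewrite /=.
have -> : (n <= n - 1)%N = false by rewrite subn1 leqNgt prednK ?leqnn// (leq_trans _ ilt).
rewrite andbF /= (_ : [seq _ <- _ | _] = [::])//.
apply/eqP; rewrite -[_ == _]negbK -has_filter; apply/hasPn => j.
rewrite mem_iota negbK => /andP[mj jn].
rewrite (leq_trans _ mj)//= nz nth_default ?size_tuple ?(ltnW mj)//.
have -> : (j == m) = false by lia.
by rewrite addn0 eqxx andbT; lia.
Qed.

Lemma Lambda_single n : (0 < n)%N -> Lambda (single_step n) = [:: 0; n]%N.
Proof.
move=> n0; have := nth_single n; move: (single_step n) => x nx; rewrite /Lambda.
have -> : n.+1 = (1 + n.-1 + 1)%N by rewrite add1n prednK// addn1.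
rewrite !iotaD !filter_cat /= add0n add1n prednK//.
have -> : (n <= n - 1)%N = false by rewrite subn1 leqNgt prednK ?leqnn.
rewrite /= add0n (_ : [seq _ <- _ | _] = [::])//.
apply/eqP; rewrite -[_ == _]negbK -has_filter; apply/hasPn => j.
rewrite mem_iota negbK add1n prednK// => /andP[j0 jn].
by rewrite nx (gtn_eqF j0) eqxx j0 andbT; lia.
Qed.

(** The sets for k >= n do not depend on k, so the recursion stays among the
sets Theta n n. *)
Lemma Theta_ge n k : (0 < n)%N -> (n <= k)%N -> Theta n k = Theta n n.
Proof.
move=> n0 nk; have [n1|n2] := leqP n 1.
  have -> : n = 1%N by apply/eqP; rewrite eqn_leq n1.
  by rewrite !Theta1.
have kF l : (n <= l)%N -> (l <= n - 1)%N = false.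
  by move=> nl; rewrite leqNgt subn1 prednK// nl.
by rewrite (ThetaE k n2) (ThetaE n n2) !kF.
Qed.

Section BigTheta.
Variable R : realType.

Lemma big_fsetU_disjoint (T : choiceType) (A B : {fset T}) (F : T -> R) :
  (forall x, x \in A -> x \in B -> False) ->
  \sum_(x <- (A `|` B)%fset) F x = \sum_(x <- A) F x + \sum_(x <- B) F x.
Proof.
move=> AB; rewrite -big_cat /=; apply: perm_big; apply: uniq_perm.
- exact: fset_uniq.
- rewrite cat_uniq !fset_uniq andbT /=; apply/hasPn => x xB.
  by apply/negP => xA; exact: (AB x).
- by move=> x; rewrite in_fsetU mem_cat.
Qed.

Lemma big_bigfcup_disjoint (I : eqType) (T : choiceType) (r : seq I) (A : I -> {fset T})
    (F : T -> R) : uniq r ->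
  (forall i j x, i \in r -> j \in r -> x \in A i -> x \in A j -> i = j) ->
  \sum_(x <- (\big[fsetU/fset0]_(i <- r) A i)%fset) F x =
  \sum_(i <- r) \sum_(x <- A i) F x.
Proof.
elim: r => [|i r IH] /=; first by rewrite !big_nil.
move=> /andP[ir ur] disj; rewrite !big_cons big_fsetU_disjoint ?IH//.
  by move=> j k x jr kr; apply: disj; rewrite inE ?jr ?kr orbT.
move=> x xi /bigfcupP[j /andP[jr _] xj].
have ij := disj i j x (mem_head _ _) _ xi xj.
by move: ir; rewrite ij ?jr// inE jr orbT.
Qed.

Lemma extend_inj n i : (0 < i < n)%N -> injective (@extend n (n - i) i).
Proof.
move=> /andP[i0 ilt] x y xy; apply: eq_from_tnth => j.
have := congr1 (fun z : n.-tuple nat => nth 0%N z j) xy.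
have mn : (n - i < n)%N by rewrite ltn_subrL i0 (leq_trans _ ilt).
rewrite !nth_extend -?lt0n// ltn_eqF// !addn0 => H.
by rewrite !(tnth_nth 0%N).
Qed.

(** The tuples split according to their last jump: either the single jump n,
or a jump i from n - i. The parts are disjoint because n - i is the last
position with a nonzero entry. *)
Lemma big_Theta n (F : n.-tuple nat -> R) : (0 < n)%N ->
  \sum_(x <- Theta n n) F x =
  \sum_(1 <= i < n) \sum_(x <- Theta (n - i) (n - i)) F (extend n i x) +
  F (single_step n).
Proof.
move=> n0; have [n1|n2] := leqP n 1.
  have n1' : n = 1%N by apply/eqP; rewrite eqn_leq n1.
  rewrite big_geq// add0r; subst n.
  rewrite /Theta /= big_seq_fset1//.
rewrite (ThetaE n n2) leqNgt ltn_subrL n0 /=.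
rewrite big_fsetU_disjoint.
  rewrite big_seq_fset1; congr (_ + _).
  rewrite big_bigfcup_disjoint ?iota_uniq//.
    apply: eq_big_nat => i ilt.
    rewrite big_imfset /=; last by move=> x y _ _; exact: extend_inj.
    rewrite Theta_ge ?subn_gt0 ?leq_subr//; by case/andP: ilt.
  move=> i j x; rewrite !mem_index_iota => iI jI.
  have key k : (1 <= k < n)%N -> x \in [fset extend n k x' | x' in Theta (n - k) n]%fset ->
      nth 0%N x (n - k) != 0%N /\ forall l, (n - k < l)%N -> nth 0%N x l = 0%N.
    move=> /andP[k0 kn] /imfsetP[y _ ->].
    have mn : (n - k < n)%N by rewrite ltn_subrL k0 (leq_trans _ kn).
    split.
      by rewrite nth_extend -?lt0n// eqxx addn_gt0 k0 orbT.
    by move=> l kl; rewrite nth_extend -?lt0n// gtn_eqF// nth_default ?size_tuple 1?ltnW.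
  move=> /(key _ iI)[xi xi'] /(key _ jI)[xj xj'].
  case/andP: iI => i0 ilt; case/andP: jI => j0 jlt.
  have : (n - i = n - j)%N.
    case: (ltngtP (n - i) (n - j)) => // ij; first by rewrite xi' in xj.
    by rewrite xj' in xi.
  by move=> /(congr1 (subn n)); rewrite !subKn// ltnW.
move=> x /bigfcupP[i]; rewrite andbT mem_index_iota => /andP[i0 ilt] /imfsetP[y _ ->].
rewrite in_fset1 => /eqP/(congr1 (fun z : n.-tuple nat => nth 0%N z (n - i))).
have mn : (n - i < n)%N by rewrite ltn_subrL i0 (leq_trans _ ilt).
rewrite nth_extend -?lt0n// eqxx nth_single gtn_eqF ?subn_gt0// => /eqP.
by rewrite addn_eq0 [i == 0%N]gtn_eqF// andbF.
Qed.

End BigTheta.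

Arguments chain_coef : simpl never.

(** * Coefficients of the series solution *)

Section Taylor.
Context {R : realType}.
Variables (lam : nat -> nat -> R) (n0 : nat).
Hypothesis lam0 : forall n, (n0 <= n)%N -> lam n 0%N = 1.
Let L m := total_rate lam (n0 + m)%N.

(** The coordinate m of A^k p(0), for the generator A of the process and the
initial state n0. *)
Fixpoint taylor (k m : nat) : R :=
  if k is k'.+1 then
    - L m * taylor k' m +
    \sum_(1 <= i < m.+1) lam (n0 + (m - i))%N i * taylor k' (m - i)%N
  else (m == 0%N)%:R.

(** Exit rates are listed backwards so that a new jump adds one at the head.
*)
Definition chain_rates n (x : n.-tuple nat) : seq R := [seq L j | j <- rev (Lambda x)].

Definition weight n (x : n.-tuple nat) : R := \prod_(j < n) lam (n0 + j)%N (tnth x j).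

Lemma weightE n (x : n.-tuple nat) :
  weight x = \prod_(0 <= j < n) lam (n0 + j)%N (nth 0%N x j).
Proof. by rewrite big_mkord; apply: eq_bigr => j _; rewrite (tnth_nth 0%N). Qed.

Lemma weight_extend n i (x : (n - i).-tuple nat) : (0 < i < n)%N ->
  weight (extend n i x) = weight x * lam (n0 + (n - i))%N i.
Proof.
move=> /andP[i0 ilt]; rewrite !weightE.
have mn : (n - i < n)%N by lia.
rewrite (@big_cat_nat _ _ _ (n - i))//=; last exact: ltnW.
congr (_ * _).
  apply: eq_big_nat => j /andP[_ jm].
  by rewrite nth_extend -?lt0n// ltn_eqF// addn0.
rewrite big_ltn// nth_extend -?lt0n// eqxx nth_default ?size_tuple// add0n.
rewrite big_nat big1 ?mulr1// => j /andP[mj jn].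
rewrite nth_extend -?lt0n// gtn_eqF// nth_default ?size_tuple 1?ltnW//.
by rewrite lam0// leq_addr.
Qed.

Lemma weight_single n : (0 < n)%N -> weight (single_step n) = lam n0 n.
Proof.
move=> n0'; rewrite weightE big_ltn// nth_single addn0 big_nat big1 ?mulr1// => j /andP[j0 _].
by rewrite nth_single gtn_eqF// lam0// leq_addr.
Qed.

Lemma chain_rates_extend n i (x : (n - i).-tuple nat) : (0 < i < n)%N ->
  chain_rates (extend n i x) = L n :: chain_rates x.
Proof. by move=> iI; rewrite /chain_rates Lambda_extend// rev_rcons. Qed.

Lemma chain_rates_single n : (0 < n)%N ->
  chain_rates (single_step n) = [:: L n; L 0%N].
Proof. by move=> n0'; rewrite /chain_rates Lambda_single. Qed.

Lemma chain_rates_neq0 n (x : n.-tuple nat) : chain_rates x != [::].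
Proof. by rewrite -size_eq0 size_map size_rev. Qed.

Lemma taylor_0 k : taylor k 0 = (- L 0%N) ^+ k.
Proof.
elim: k => [|k IH] /=; first by rewrite expr0.
by rewrite big_geq// addr0 IH exprS.
Qed.

(** Splitting each chain at its last jump, the sum over Theta satisfies the
recursion that defines taylor. *)
Lemma taylor_Theta k m : (0 < m)%N ->
  taylor k m = \sum_(x <- Theta m m) weight x * chain_coef k (chain_rates x).
Proof.
elim: k m => [|k IH] m m0.
  rewrite /= gtn_eqF// big_Theta// big_nat big1 => [|i iI].
    by rewrite chain_rates_single// chain_coef0 mulr0 addr0.
  rewrite big1 // => x _.
  by rewrite chain_rates_extend// chain_coef0 (negbTE (chain_rates_neq0 x)) mulr0.
rewrite /= IH// big_distrr /= big_Theta// [RHS]big_Theta//.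
(* The jump i = m starts from the initial state and matches single_step. *)
rewrite big_nat_recr//= subnn addn0 taylor_0 addrACA; congr (_ + _); last first.
  rewrite chain_rates_single// chain_coefS chain_coef1 weight_single//.
  by rewrite mulrCA -mulrDr mulNr addrC.
rewrite -big_split /=; apply: eq_big_nat => i iI.
have mi0 : (0 < m - i)%N by lia.
rewrite IH// [X in _ + X]big_distrr /= -big_split /=; apply: eq_bigr => x _.
rewrite chain_rates_extend// chain_coefS weight_extend//.
by move: (chain_coef _ _) (chain_coef _ _) => u v; ring.
Qed.

End Taylor.

(** * From the Caputo derivative to a Volterra equation *)

Section Volterra.
Context {R : realType}.
Notation mu := (@lebesgue_measure R).
Implicit Types (a b t : R) (f g h : R -> R).

Lemma integral_kern_mkcond a b t h : b = a - 1 ->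
  (\int[mu]_(s in `]0%R, t[) ((t - s) `^ b * h s)%:E =
   \int[mu]_s (kern a (t - s) * (h \_ `]0%R, t[) s)%:E)%E.
Proof.
move=> ->; rewrite integral_mkcond; apply: eq_integral => s _.
rewrite !patchE; case: ifPn => [|_]; last by rewrite mulr0.
by rewrite inE /= in_itv /= /kern subr_gt0 => /andP[_ ->].
Qed.

Lemma measurable_kern_convl b (phi : R -> R) : measurable_fun setT phi ->
  (forall s, 0 <= phi s) ->
  measurable_fun setT (fun s : R => \int[mu]_r (kern b (s - r) * phi r)%:E)%E.
Proof.
move=> mphi phi0.
pose F (z : R * R) : \bar R := (kern b (z.1 - z.2) * phi z.2)%:E.
have mF : measurable_fun setT F.
  apply/measurable_EFinP; apply: measurable_funM; last exact: measurableT_comp.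
  by apply: measurableT_comp; [exact: measurable_kern|apply: measurable_funB].
have F0 z : (0 <= F z)%E by rewrite lee_fin !mulr_ge0 ?kern_ge0.
exact: (measurable_fun_fubini_tonelli_F (m2 := mu) F mF F0).
Qed.

Lemma integral_kern_full a b s (phi : R -> R) : b = a - 1 ->
  (forall r, r <= 0 -> phi r = 0) ->
  (\int[mu]_(r in `]0%R, s[) ((s - r) `^ b * phi r)%:E =
   \int[mu]_r (kern a (s - r) * phi r)%:E)%E.
Proof.
move=> ba phi0; rewrite (@integral_kern_mkcond a)//; apply: eq_integral => r _.
rewrite patchE; case: (boolP (r \in _)) => //.
rewrite notin_setE /= in_itv /= => /negP; rewrite negb_and -!leNgt => /orP[r0|sr].
  by rewrite phi0.
by rewrite /kern subr_gt0 ltNge sr /= !mul0r.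
Qed.

(** The semigroup law for the orders a and 1 - a: the composed kernel is the
indicator of ]0, +oo[. *)
Lemma abel_inversion_ge0 a (phi : R -> R) t : 0 < a < 1 ->
  measurable_fun setT phi -> (forall s, 0 <= phi s) ->
  (forall r, r <= 0 -> phi r = 0) ->
  (\int[mu]_(s in `]0%R, t[) ((kern a (t - s))%:E *
      \int[mu]_r (kern (1 - a) (s - r) * phi r)%:E) =
   (Gamma a * Gamma (1 - a))%:E * \int[mu]_(s in `]0%R, t[) (phi s)%:E)%E.
Proof.
move=> /andP[a0 a1] mphi phi0 phiN.
have a1' : 0 < 1 - a by rewrite subr_gt0.
have := kern_convA t a0 a1' mphi phi0.
have -> : a + (1 - a) = 1 by ring.
rewrite Gamma1 divr1 -(@integral_kern_full 1 0 t phi) ?subrr//.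
under [X in _ = (_ * X)%E -> _]eq_integral do rewrite powRr0 mul1r.
move=> <-; rewrite integral_mkcond; apply: eq_integral => s _; rewrite patchE.
case: (boolP (s \in _)) => //.
rewrite notin_setE /= in_itv /= => /negP; rewrite negb_and -!leNgt => /orP[s0|ts].
  rewrite integral0_eq ?mule0// => r _; have [rs|rs] := ltP r s.
    by rewrite phiN ?mulr0// (le_trans (ltW rs)).
  by rewrite /kern subr_gt0 ltNge rs /= mul0r.
by rewrite /kern subr_gt0 ltNge ts /= mul0e.
Qed.

(** Tonelli needs nonnegative functions, so the derivative of f is split into
its positive and negative parts. Their integrals of order 1 - a are finite
where the Caputo derivative exists, Abel's inversion turns them into integrals
over ]0, t[, and the difference of these is f t - f 0. *)
Lemma caputo_volterra_lt1 a f g t : 0 < a < 1 ->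
  f s @[s --> 0^'+] --> f 0 ->
  (forall s : R, 0 < s -> caputo_derivable a f s) ->
  (forall s : R, 0 < s -> caputo a f s = g s) -> 0 < t ->
  mu.-integrable `]0, t[ (fun s => ((t - s) `^ (a - 1) * g s)%:E) /\
  (\int[mu]_(s in `]0%R, t[) ((t - s) `^ (a - 1) * g s)%:E =
   (Gamma a * (f t - f 0))%:E)%E.
Proof.
move=> a01 f0 df fg t0; have /andP[a0 a1] := a01.
have a1' : 0 < 1 - a by rewrite subr_gt0.
have G1 := Gamma_gt0 a1'.
have dfs (s : R) : 0 < s -> derivable f s 1.
  move=> s0; have := df (s + 1); rewrite ltr_wpDl ?ltW// => /(_ isT).
  rewrite /caputo_derivable lt_eqF// => -[+ _]; apply.
  by rewrite s0 ltrDl ltr01.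
pose F s r : \bar R := ((s - r) `^ (- a) * derive1 f r)%:E.
have iF (s : R) : 0 < s -> mu.-integrable `]0, s[ (F s).
  by move=> /df; rewrite /caputo_derivable lt_eqF// => -[].
have eF (s : R) : 0 < s -> (\int[mu]_(r in `]0%R, s[) F s r = (Gamma (1 - a) * g s)%:E)%E.
  move=> s0; rewrite -fg// /caputo lt_eqF// mulVKf ?gt_eqF// fineK//.
  by apply: integrable_fin_num => //; exact: iF.
set D := `]0, t[%classic.
have mD : measurable D by exact: measurable_itv.
have mD' : measurable (D : set (measurableTypeR R)) by exact: measurable_itv.
have cancelw (s r : R) : r < s -> (s - r) `^ a * (s - r) `^ (- a) = 1.
  by move=> rs; rewrite powRN mulfV// gt_eqF// powR_gt0// subr_gt0.
have mdf : measurable_fun D (derive1 f).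
  have mF : measurable_fun D (fun r => (t - r) `^ (- a) * derive1 f r).
    by apply/measurable_EFinP; exact: measurable_int (iF t t0).
  have : measurable_fun D (fun r => (t - r) `^ a * ((t - r) `^ (- a) * derive1 f r)).
    apply: measurable_funM => //.
    apply: (measurableT_comp (measurable_powR a)); exact: measurable_funB.
  apply: eq_measurable_fun => r /set_mem; rewrite /D /= in_itv /= => /andP[_ rt].
  by rewrite mulrA cancelw// mul1r.
(* On D the weight (t - r)^(- a) is at least t^(- a). *)
have idf : mu.-integrable D (fun s => (derive1 f s)%:E).
  have iFt : mu.-integrable D (fun r => (t `^ a)%:E * F t r)%E.
    by apply: integrableZl => //; exact: iF.
  apply: (le_integrable _ _ _ iFt) => //; first exact/measurable_EFinP.
  move=> r; rewrite /D /= in_itv /= => /andP[r0 rt].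
  rewrite lee_fin -[X in `|X|]mul1r -(cancelw _ _ rt).
  rewrite -mulrA normrM [in leRHS]normrM ler_wpM2r//.
  rewrite !ger0_norm ?powR_ge0// ge0_ler_powR ?(ltW a0)// ?nnegrE ?subr_ge0 ?ltW//.
  by rewrite ltrBlDr ltrDl.
pose phi := derive1 f \_ D.
have mphi : measurable_fun setT phi by apply/(measurable_restrictT _ _).1.
pose pos r := Num.max (phi r) 0; pose neg r := Num.max (- phi r) 0.
have mpos : measurable_fun setT pos by apply: measurable_maxr.
have mneg : measurable_fun setT neg.
  by apply: measurable_maxr => //; exact: measurableT_comp.
have pos0 r : 0 <= pos r by rewrite le_max lexx orbT.
have neg0 r : 0 <= neg r by rewrite le_max lexx orbT.
have phiN r : r <= 0 -> phi r = 0.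
  by move=> r0; rewrite /phi patchE memNset// /D /= in_itv /= ltNge r0.
have posN r : r <= 0 -> pos r = 0 by move=> r0; rewrite /pos phiN// maxxx.
have negN r : r <= 0 -> neg r = 0 by move=> r0; rewrite /neg phiN// oppr0 maxxx.
pose J (sg : R -> R) s := (\int[mu]_r (kern (1 - a) (s - r) * sg r)%:E)%E.
have phiE (s r : R) : s <= t -> r \in `]0, s[%classic -> phi r = derive1 f r.
  move=> st; rewrite inE /= in_itv /= => /andP[r0 rs].
  by rewrite /phi patchE mem_set// /D /= in_itv /= r0 (lt_le_trans rs st).
have FpE (s : R) : s <= t -> J pos s = (\int[mu]_(r in `]0%R, s[) (F s)^\+ r)%E.
  move=> st; rewrite /J -(@integral_kern_full _ (- a)) //; last by ring.
  apply: eq_integral => r rs; rewrite /pos (phiE s)// funeposE /F.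
  by rewrite maxr_pMr ?powR_ge0// mulr0 EFin_max.
have FnE (s : R) : s <= t -> J neg s = (\int[mu]_(r in `]0%R, s[) (F s)^\- r)%E.
  move=> st; rewrite /J -(@integral_kern_full _ (- a)) //; last by ring.
  apply: eq_integral => r rs; rewrite /neg (phiE s)// funenegE /F.
  by rewrite -EFinN maxr_pMr ?powR_ge0// mulr0 mulrN EFin_max.
have Jpos_fin (s : R) : 0 < s -> s <= t -> J pos s \is a fin_num.
  move=> s0 st; rewrite FpE//; apply: integrable_pos_fin_num => //; exact: iF.
have Jneg_fin (s : R) : 0 < s -> s <= t -> J neg s \is a fin_num.
  move=> s0 st; rewrite FnE//; apply: integrable_neg_fin_num => //; exact: iF.
have JB (s : R) : 0 < s -> s <= t -> (J pos s - J neg s = (Gamma (1 - a) * g s)%:E)%E.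
  by move=> s0 st; rewrite FpE// FnE// -eF// -integralE.
have Apos := abel_inversion_ge0 t a01 mpos pos0 posN.
have Aneg := abel_inversion_ge0 t a01 mneg neg0 negN.
have Ipos : (\int[mu]_(s in D) (pos s)%:E = \int[mu]_(s in D) (EFin \o derive1 f)^\+ s)%E.
  by apply: eq_integral => r rD; rewrite /pos (phiE t)// funeposE /= EFin_max.
have Ineg : (\int[mu]_(s in D) (neg s)%:E = \int[mu]_(s in D) (EFin \o derive1 f)^\- s)%E.
  by apply: eq_integral => r rD; rewrite /neg (phiE t)// funenegE /= EFin_max.
have intA (sg : R -> R) : measurable_fun setT sg -> (forall r, 0 <= sg r) ->
    (\int[mu]_(s in D) ((kern a (t - s))%:E * J sg s))%E \is a fin_num ->
    mu.-integrable D (fun s => (kern a (t - s))%:E * J sg s)%E.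
  move=> msg sg0 fin.
  have J0 s : (0 <= (kern a (t - s))%:E * J sg s)%E.
    apply: mule_ge0; first by rewrite lee_fin kern_ge0.
    by apply: integral_ge0 => r _; rewrite lee_fin mulr_ge0 ?kern_ge0.
  apply/integrableP; split.
    apply: measurable_funTS; apply: emeasurable_funM.
      apply/measurable_EFinP; apply: measurableT_comp; first exact: measurable_kern.
      exact: measurable_funB.
    exact: measurable_kern_convl.
  under eq_integral do rewrite gee0_abs//.
  by rewrite -ge0_fin_numE// integral_ge0.
have idf' : mu.-integrable D (EFin \o derive1 f) by exact: idf.
have iApos : mu.-integrable D (fun s => (kern a (t - s))%:E * J pos s)%E.
  apply: intA => //; rewrite Apos fin_numM// Ipos; exact: integrable_pos_fin_num.
have iAneg : mu.-integrable D (fun s => (kern a (t - s))%:E * J neg s)%E.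
  apply: intA => //; rewrite Aneg fin_numM// Ineg; exact: integrable_neg_fin_num.
have AE (s : R) : s \in D -> ((kern a (t - s))%:E * J pos s - (kern a (t - s))%:E * J neg s
    = (Gamma (1 - a))%:E * ((t - s) `^ (a - 1) * g s)%:E)%E.
  rewrite inE /D /= in_itv /= => /andP[s0 st].
  rewrite -muleBr//; last first.
    by apply: fin_num_adde_defr; rewrite ?fin_numN ?Jpos_fin// ?Jneg_fin// ltW.
  by rewrite JB ?(ltW st)// /kern subr_gt0 st -!EFinM mulrCA.
have iA : mu.-integrable D (fun s => (Gamma (1 - a))%:E * ((t - s) `^ (a - 1) * g s)%:E)%E.
  have := integrableB mD' iApos iAneg.
  by apply: eq_integrable => // s sD; exact: AE.
have ig : mu.-integrable D (fun s => ((t - s) `^ (a - 1) * g s)%:E).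
  have := integrableZl mD' (Gamma (1 - a))^-1 iA.
  apply: eq_integrable => // s _.
  by rewrite -!EFinM mulKf// gt_eqF.
split => //.
have FTC : (\int[mu]_(s in D) (derive1 f s)%:E = (f t - f 0)%:E)%E.
  apply: everywhere_derivable_FTC2 => //.
    apply/continuous_within_itvP => //; split => //.
    - move=> s; rewrite in_itv /= => /andP[s0 _].
      by apply: differentiable_continuous; apply/derivable1_diffP; exact: dfs.
    - apply: cvg_at_left_filter.
      by apply: differentiable_continuous; apply/derivable1_diffP; exact: dfs.
  by move=> s; rewrite in_itv /= => /andP[s0 _]; exact: dfs.
have FTC' : (\int[mu]_(s in D) (pos s)%:E - \int[mu]_(s in D) (neg s)%:E = (f t - f 0)%:E)%E.
  by rewrite Ipos Ineg -integralE; exact: FTC.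
have E : ((Gamma (1 - a))%:E * \int[mu]_(s in D) ((t - s) `^ (a - 1) * g s)%:E =
    (Gamma a * Gamma (1 - a))%:E * (f t - f 0)%:E)%E.
  rewrite -integralZl// -FTC' muleBr//; last first.
    apply: fin_num_adde_defr; rewrite ?fin_numN ?Ipos ?Ineg.
    by rewrite ?integrable_neg_fin_num ?integrable_pos_fin_num.
  rewrite -Apos -Aneg -integralB//.
  by apply: eq_integral => s sD; rewrite AE.
move: E; rewrite -(fineK (integrable_fin_num mD' ig)) -!EFinM => -[E].
congr (_%:E); apply: (@mulfI _ (Gamma (1 - a))); first by rewrite gt_eqF.
have regroup (x y z : R) : x * y * z = y * (x * z) by rewrite -mulrA mulrCA.
exact: etrans E (regroup _ _ _).
Qed.

End Volterra.

Section AbelIntegral.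
Context {R : realType}.
Notation mu := (@lebesgue_measure R).
Implicit Types (a b t v w c : R) (f g h : R -> R).

(** Integrability is part of the relation, so that values add up. *)
Definition abel_integral a t f v :=
  mu.-integrable `]0, t[ (fun s => ((t - s) `^ (a - 1) * f s)%:E) /\
  (\int[mu]_(s in `]0%R, t[) ((t - s) `^ (a - 1) * f s)%:E = v%:E)%E.

Lemma measurable_oo t : measurable (`]0, t[%classic : set (measurableTypeR R)).
Proof. exact: measurable_itv. Qed.

Lemma abel_integral_eq a t f g v : {in `]0, t[, f =1 g} ->
  abel_integral a t f v -> abel_integral a t g v.
Proof.
move=> fg [If Ef]; split.
  by apply: eq_integrable If => // s /set_mem sD; rewrite fg.
by rewrite -Ef; apply: eq_integral => s /set_mem sD; rewrite fg.
Qed.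

Lemma abel_integral0 a t : abel_integral a t (fun=> 0) 0.
Proof.
split.
  by apply: eq_integrable (integrable0 _ _) => // s _ /=; rewrite mulr0.
by rewrite integral0_eq// => s _; rewrite mulr0.
Qed.

Lemma abel_integralD a t f g v w :
  abel_integral a t f v -> abel_integral a t g w ->
  abel_integral a t (fun s => f s + g s) (v + w).
Proof.
move=> [If Ef] [Ig Eg]; split.
  have := integrableD (measurable_oo t) If Ig.
  by apply: eq_integrable => // s _; rewrite mulrDr EFinD.
rewrite EFinD -Ef -Eg -integralD//.
by apply: eq_integral => s _; rewrite mulrDr EFinD.
Qed.

Lemma abel_integralZ a t c f v :
  abel_integral a t f v -> abel_integral a t (fun s => c * f s) (c * v).
Proof.
move=> [If Ef]; split.
  have := integrableZl (measurable_oo t) c If.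
  by apply: eq_integrable => // s _; rewrite -EFinM mulrCA.
rewrite EFinM -Ef -integralZl//.
by apply: eq_integral => s _; rewrite -EFinM mulrCA.
Qed.

Lemma abel_integral_sum a t (I : Type) (r : seq I) (f : I -> R -> R) (v : I -> R) :
  (forall i, abel_integral a t (f i) (v i)) ->
  abel_integral a t (fun s => \sum_(i <- r) f i s) (\sum_(i <- r) v i).
Proof.
move=> H; elim: r => [|i r IH].
  rewrite big_nil; apply: abel_integral_eq (abel_integral0 a t) => s _.
  by rewrite big_nil.
rewrite big_cons; apply: abel_integral_eq (abel_integralD (H i) IH) => s _.
by rewrite big_cons.
Qed.

Lemma abel_integral_le a t f g v w : {in `]0, t[, forall s, `|f s| <= g s} ->
  abel_integral a t f v -> abel_integral a t g w -> `|v| <= w.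
Proof.
move=> fg [If Ef] [Ig Eg]; rewrite -lee_fin -abse_EFin -Ef -Eg.
have mf := measurable_int _ If.
apply: le_trans (le_abse_integral _ (measurable_oo t) mf) _.
apply: ge0_le_integral => //.
- exact: measurableT_comp.
- exact: measurable_int Ig.
- move=> s sD; rewrite lee_fin normrM ger0_norm ?powR_ge0//.
  by rewrite ler_wpM2l ?powR_ge0// fg.
Qed.

Lemma derivable_of_caputo a f : (forall t, 0 < t -> caputo_derivable a f t) ->
  forall t, 0 < t -> derivable f t 1.
Proof.
move=> df t t0; have := df (t + 1); rewrite addr_gt0// => /(_ isT).
have := df t t0; rewrite /caputo_derivable; case: ifP => // _ _ [+ _]; apply.
by rewrite t0 ltrDl ltr01.
Qed.

(** For a = 1 the kernel is constant and only the fundamental theorem of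
calculus is left. *)
Lemma caputo_volterra a f g t : 0 < a <= 1 ->
  f s @[s --> 0^'+] --> f 0 ->
  (forall s : R, 0 < s -> caputo_derivable a f s) ->
  (forall s : R, 0 < s -> caputo a f s = g s) -> 0 < t ->
  mu.-integrable `]0, t[ (EFin \o g) ->
  abel_integral a t g (Gamma a * (f t - f 0)).
Proof.
move=> /andP[a0]; rewrite le_eqVlt => /predU1P[->|a1] f0 df fg t0 ig; last first.
  by apply: caputo_volterra_lt1 => //; rewrite a0.
have dfs := derivable_of_caputo df.
have dfE s : s \in `]0, t[ -> derive1 f s = g s.
  by rewrite in_itv /= => /andP[s0 _]; rewrite -fg// /caputo eqxx.
have idf : mu.-integrable `]0, t[ (fun s => (derive1 f s)%:E).
  by apply: eq_integrable ig => // s /set_mem sD /=; rewrite dfE.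
split.
  by apply: eq_integrable ig => // s _ /=; rewrite subrr powRr0 mul1r.
rewrite Gamma1 mul1r -(everywhere_derivable_FTC2 t0 _ _ idf).
- apply: eq_integral => s /set_mem sD; rewrite subrr powRr0 mul1r dfE//.
- apply/continuous_within_itvP => //; split => //.
  + move=> s; rewrite in_itv /= => /andP[s0 _].
    by apply: differentiable_continuous; apply/derivable1_diffP; exact: dfs.
  + apply: cvg_at_left_filter.
    by apply: differentiable_continuous; apply/derivable1_diffP; exact: dfs.
- by move=> s; rewrite in_itv /= => /andP[s0 _]; exact: dfs.
Qed.

(** The Riemann-Liouville integral of order k a of the constant 1. *)
Definition tau a (k : nat) t : R := (t `^ a) ^+ k / Gamma (k%:R * a + 1).

Lemma ML_arg_gt0 a (k : nat) : 0 < a -> 0 < k%:R * a + 1.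
Proof. by move=> a0; rewrite ltr_wpDl// mulr_ge0// ltW. Qed.

Lemma tau_ge0 a k t : 0 < a -> 0 <= tau a k t.
Proof.
by move=> a0; rewrite divr_ge0 ?exprn_ge0 ?powR_ge0// ltW// Gamma_gt0 ?ML_arg_gt0.
Qed.

Lemma tau0 a t : tau a 0 t = 1.
Proof. by rewrite /tau expr0 mul0r add0r Gamma1 divr1. Qed.

Lemma abel_integral_tau a k t : 0 < a -> 0 < t ->
  abel_integral a t (tau a k) (Gamma a * tau a k.+1 t).
Proof.
move=> a0 t0; have ka0 := ML_arg_gt0 k a0.
have G0 := Gamma_gt0 ka0.
suff H : abel_integral a t (fun s => (s `^ a) ^+ k)
    (Gamma (k%:R * a + 1) * (Gamma a * tau a k.+1 t)).
  have := abel_integralZ (Gamma (k%:R * a + 1))^-1 H.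
  rewrite mulKf ?gt_eqF//; apply: abel_integral_eq => s _.
  by rewrite /tau mulrC.
have E : (\int[mu]_(s in `]0%R, t[) ((t - s) `^ (a - 1) * (s `^ a) ^+ k)%:E =
    (Gamma (k%:R * a + 1) * (Gamma a * tau a k.+1 t))%:E)%E.
  transitivity (\int[mu]_(s in `]0%R, t[) ((t - s) `^ (a - 1) * kern (k%:R * a + 1) s)%:E)%E.
    apply: eq_integral => s /set_mem /=; rewrite in_itv /= => /andP[s0 _].
    by rewrite /kern s0 addrK [k%:R * a]mulrC powRrM powR_mulrn ?powR_ge0.
  rewrite (@integral_kern_full _ a)//; last by move=> r r0; rewrite /kern ltNge r0.
  rewrite kern_conv//; congr (_%:E).
  have -> : a + (k%:R * a + 1) = k.+1%:R * a + 1 by rewrite -natr1; ring.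
  rewrite /tau /kern t0 addrK [k.+1%:R * a]mulrC powRrM powR_mulrn ?powR_ge0//.
  by rewrite (mulrC a); move: (Gamma (k%:R * a + 1)) (Gamma a) (_ ^+ _) (_^-1) => u v w z; ring.
split => //; apply/integrableP; split.
  apply/measurable_EFinP; apply: measurable_funTS; apply: measurable_funM.
    apply: (measurableT_comp (measurable_powR (a - 1))); exact: measurable_funB.
  apply: measurable_funX; exact: measurable_powR.
under eq_integral => s _.
  rewrite abse_EFin ger0_norm; last by rewrite mulr_ge0 ?exprn_ge0 ?powR_ge0.
  over.
by rewrite E ltry.
Qed.

(** The lower bound Gamma_ge for B such that B^a = 2 (M t^a + 1). *)
Lemma tau_geometric a t M : 0 < a -> 0 <= M ->
  exists2 C, 0 <= C & forall k, M ^+ k * tau a k t <= C * 2^-1 ^+ k.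
Proof.
move=> a0 M0; pose X := 2 * (M * t `^ a + 1).
have X0 : 0 < X by rewrite mulr_gt0// ltr_wpDl// mulr_ge0// powR_ge0.
pose B := X `^ a^-1.
have B0 : 0 < B by rewrite powR_gt0.
have Ba : B `^ a = X by rewrite -powRrM mulVf ?gt_eqF// powRr1// ltW.
exists (expR B); first exact: expR_ge0.
move=> k; have ka0 : 0 <= k%:R * a by rewrite mulr_ge0// ltW.
have := Gamma_ge ka0 B0.
rewrite [k%:R * a]mulrC powRrM Ba powR_mulrn ?(ltW X0)// [a * _]mulrC => G.
rewrite /tau mulrA ler_pdivrMr ?Gamma_gt0 ?ML_arg_gt0//.
apply: (@le_trans _ _ (expR B * 2^-1 ^+ k * (X ^+ k * expR (- B)))); last first.
  by rewrite ler_wpM2l// mulr_ge0 ?expR_ge0// exprn_ge0.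
have regroup (x y z w : R) : w * z ^+ k * (x ^+ k * y) = (x * z) ^+ k * (w * y).
  by rewrite exprMn; ring.
have XM : M * t `^ a <= X / 2 by rewrite /X mulrAC divff// mul1r lerDl.
have M0' : 0 <= M * t `^ a by rewrite mulr_ge0// powR_ge0.
by rewrite regroup -expRD subrr expR0 mulr1 -exprMn lerXn2r ?nnegrE// (le_trans M0').
Qed.

Lemma cvg_tau_series a t M (w : nat -> R) : 0 < a -> 0 <= M ->
  (forall k, `|w k| <= M ^+ k) -> cvgn (series (fun k => w k * tau a k t)).
Proof.
move=> a0 M0 wM; have [C C0 HC] := tau_geometric t a0 M0.
apply: normed_cvg.
apply: (@series_le_cvg _ _ (fun k => C * 2^-1 ^+ k)) => //.
- by move=> k /=.
- by move=> k; rewrite mulr_ge0// exprn_ge0.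
- move=> k /=; rewrite normrM (le_trans _ (HC k))// (ger0_norm (tau_ge0 k t a0))//.
  by rewrite ler_wpM2r ?tau_ge0.
- apply: is_cvg_geometric_series.
  by rewrite ger0_norm// invf_lt1// ltr1n.
Qed.

End AbelIntegral.

(** * Iteration of the Volterra equation *)

Section SeriesSolution.
Context {R : realType}.
Variables (lam : nat -> nat -> R) (n0 : nat) (a : R) (p : nat -> R -> R).
Let L m := total_rate lam (n0 + m)%N.
Let rhs m s := - (L m * p m s) +
  \sum_(1 <= i < m.+1) lam (n0 + (m - i))%N i * p (m - i)%N s.
Hypothesis a0 : 0 < a.
Hypothesis p_bound : forall m t, 0 <= t -> `|p m t| <= 1.
Hypothesis p_init : forall m, p m 0 = (m == 0%N)%:R.
Hypothesis p_abel : forall m t, 0 < t ->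
  abel_integral a t (rhs m) (Gamma a * (p m t - p m 0)).

Let S K m t := \sum_(k < K) taylor lam n0 k m * tau a k t.

(** The error of order K + 1 is the Abel integral of A applied to the error of
order K, and M bounds the row sums of |A| up to N. *)
Lemma taylor_remainder N M :
  (forall m, (m <= N)%N ->
    `|L m| + \sum_(1 <= i < m.+1) `|lam (n0 + (m - i))%N i| <= M) ->
  forall K m t, (m <= N)%N -> 0 < t ->
    `|p m t - S K m t| <= M ^+ K * tau a K t.
Proof.
move=> HM; elim=> [|K IH] m t mN t0.
  by rewrite /S big_ord0 subr0 expr0 mul1r tau0 p_bound// ltW.
pose h s := rhs m s + -1 * \sum_(k < K) taylor lam n0 k.+1 m * tau a k s.
have hE s : h s = - (L m * (p m s - S K m s)) +
    \sum_(1 <= i < m.+1) lam (n0 + (m - i))%N i * (p (m - i)%N s - S K (m - i)%N s).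
  rewrite /h /rhs mulN1r.
  have -> : \sum_(k < K) taylor lam n0 k.+1 m * tau a k s =
      - (L m * S K m s) + \sum_(1 <= i < m.+1) lam (n0 + (m - i))%N i * S K (m - i)%N s.
    rewrite /S mulr_sumr -sumrN.
    under [X in _ = _ + X]eq_bigr do rewrite mulr_sumr.
    rewrite exchange_big -big_split /=; apply: eq_bigr => k _.
    rewrite mulrDl mulr_suml; congr (_ + _); first by rewrite !mulNr mulrA.
    by apply: eq_bigr => i _; rewrite mulrA.
  under [X in _ = _ + X]eq_bigr do rewrite mulrBr.
  by rewrite big_split /= sumrN mulrBr; ring.
have Ih : abel_integral a t h (Gamma a * (p m t - S K.+1 m t)).
  have -> : Gamma a * (p m t - S K.+1 m t) = Gamma a * (p m t - p m 0) +
      -1 * \sum_(k < K) taylor lam n0 k.+1 m * (Gamma a * tau a k.+1 t).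
    rewrite /S big_ord_recl tau0 mulr1 /= -p_init.
    have -> : \sum_(k < K) taylor lam n0 k.+1 m * (Gamma a * tau a k.+1 t) =
       Gamma a * \sum_(k < K) taylor lam n0 k.+1 m * tau a k.+1 t.
      by rewrite mulr_sumr; apply: eq_bigr => k _; rewrite mulrCA.
    by move: (\sum_(k < K) _) => u; ring.
  apply: abel_integralD; first exact: p_abel.
  apply: abel_integralZ; apply: abel_integral_sum => k.
  by apply: abel_integralZ; exact: abel_integral_tau.
have It := abel_integralZ (M ^+ K.+1) (abel_integral_tau K a0 t0).
have := abel_integral_le _ Ih It.
rewrite normrM (gtr0_norm (Gamma_gt0 a0)) mulrCA ler_pM2l ?Gamma_gt0//; apply.
move=> s; rewrite in_itv /= => /andP[s0 st].
have B j : (j <= m)%N -> `|p j s - S K j s| <= M ^+ K * tau a K s.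
  by move=> jm; apply: IH => //; exact: leq_trans mN.
rewrite hE (le_trans (ler_normD _ _))// normrN normrM.
apply: (@le_trans _ _ ((`|L m| + \sum_(1 <= i < m.+1) `|lam (n0 + (m - i))%N i|) *
    (M ^+ K * tau a K s))).
  rewrite mulrDl; apply: lerD; first by rewrite ler_wpM2l// B.
  rewrite (le_trans (ler_norm_sum _ _ _))// mulr_suml; apply: ler_sum => i _.
  by rewrite normrM ler_wpM2l// B// leq_subr.
have MK0 : 0 <= M ^+ K * tau a K s by apply: le_trans (B m (leqnn m)).
by rewrite exprS -mulrA ler_wpM2r// HM.
Qed.

(** A bound M valid for the rows up to m is enough, because A is lower
triangular. *)
Lemma cvg_taylor_series m t : 0 <= t ->
  series (fun k => taylor lam n0 k m * tau a k t) N @[N --> \oo] --> p m t.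
Proof.
have SE N s : series (fun k => taylor lam n0 k m * tau a k s) N = S N m s.
  by rewrite /series /= big_mkord.
rewrite le_eqVlt => /predU1P[<-|t0].
  apply: cvg_near_cst; near=> N.
  have N0 : (0 < N)%N by near: N; exact: nbhs_infty_gt.
  rewrite SE /S -(prednK N0) big_ord_recl tau0 mulr1 big1 ?addr0 ?p_init// => k _.
  by rewrite /tau powR0 ?gt_eqF// expr0n /= mul0r mulr0.
pose c j := `|L j| + \sum_(1 <= i < j.+1) `|lam (n0 + (j - i))%N i|.
have c0 j : 0 <= c j by rewrite addr_ge0// sumr_ge0.
pose M := \sum_(j < m.+1) c j.
have M0 : 0 <= M by apply: sumr_ge0.
have cM j : (j <= m)%N -> c j <= M.
  move=> jm; rewrite /M (bigD1 (inord j))//= inordK ?ltnS// lerDl.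
  by apply: sumr_ge0.
have [C C0 HC] := tau_geometric t a0 M0.
have half : `|2^-1 : R| < 1 by rewrite ger0_norm// invf_lt1// ltr1n.
apply/cvgrPdist_le => e e0.
have /cvgrPdist_le /(_ e e0) geo_small := cvg_geometric C half.
near=> K.
rewrite SE (le_trans (taylor_remainder cM K (leqnn m) t0))//.
rewrite (le_trans (HC K))//.
have : `|geometric C 2^-1 K| <= e.
  by near: K; apply: filterS geo_small => n; rewrite sub0r normrN.
by apply: le_trans; exact: ler_norm.
Unshelve. all: end_near. Qed.

End SeriesSolution.

(** * State probabilities *)

Section StateProbabilities.
Context {R : realType}.

Lemma state_prob_norm_le1 (d : measure_display) (T : measurableType d)
    (P : probability T R) (X : R -> T -> \bar R) n t :
  measurable_fun setT (X t) -> `|state_prob P X n t| <= 1.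
Proof.
move=> mX; rewrite /state_prob.
have mA : measurable [set w | X t w = (n%:R)%:E].
  rewrite -[X in measurable X]setTI.
  by apply: (mX measurableT [set (n%:R)%:E]); exact: emeasurable_set1.
have P1 := probability_le1 P mA.
have P0 : (0 <= P [set w | X t w = (n%:R)%:E])%E by exact: measure_ge0.
rewrite ger0_norm ?fine_ge0// -lee_fin fineK//.
by rewrite ge0_fin_numE// (le_lt_trans P1)// ltry.
Qed.

Lemma measurable_derivable_oo (f : R -> R) (t : R) :
  (forall s, 0 < s -> derivable f s 1) -> measurable_fun `]0, t[ f.
Proof.
move=> df; apply: open_continuous_measurable_fun; first exact: interval_open.
move=> s /set_mem; rewrite /= in_itv /= => /andP[s0 _].
by apply: differentiable_continuous; apply/derivable1_diffP; exact: df.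
Qed.

Lemma integrable_bounded_oo (f : R -> R) (t M : R) : measurable_fun `]0, t[ f ->
  (forall s, s \in `]0, t[ -> `|f s| <= M) -> (@lebesgue_measure R).-integrable `]0, t[ (EFin \o f).
Proof.
move=> mf fM; have iM := @integrable_cst_oo R 0 t M.
apply: (le_integrable _ _ _ iM) => //; first exact/measurable_EFinP.
move=> s sD; rewrite /= lee_fin (le_trans (fM s sD))//; exact: ler_norm.
Qed.

Lemma cvg_series_sum (I : Type) (r : seq I) (w : I -> R) (u : I -> R ^nat) :
  (forall i, cvgn (series (u i))) ->
  series (fun k => \sum_(i <- r) w i * u i k) N @[N --> \oo] -->
    \sum_(i <- r) w i * limn (series (u i)).
Proof.
move=> cu.
have -> : (fun N => series (fun k => \sum_(i <- r) w i * u i k) N) =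
    (fun N => \sum_(i <- r) w i * series (u i) N).
  apply/funext => N; rewrite /series /= exchange_big; apply: eq_bigr => i _.
  by rewrite mulr_sumr.
elim: r => [|i r IH].
  under eq_fun do rewrite big_nil; rewrite big_nil; exact: cvg_cst.
under eq_fun do rewrite big_cons; rewrite big_cons.
by apply: cvgD => //; apply: cvgM; [exact: cvg_cst|exact: cu].
Qed.

Lemma mittag_leffler_tau (a t c : R) :
  mittag_leffler a (- (c * t `^ a)) = limn (series (fun k => (- c) ^+ k * tau a k t)).
Proof.
rewrite /mittag_leffler; congr (limn (series _)); apply/funext => k.
by rewrite -mulNr exprMn mulrA.
Qed.

Lemma total_rate_gt0 (lam : nat -> nat -> R) n :
  (forall i, (1 <= i)%N -> 0 < lam n i) ->
  cvgn (series (fun i : nat => lam n i.+1)) -> 0 < total_rate lam n.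
Proof.
move=> lam0 cv; apply: (@lt_le_trans _ _ (lam n 1%N)); first exact: lam0.
apply: limr_ge => //; near=> N.
have N0 : (0 < N)%N by near: N; exact: nbhs_infty_gt.
rewrite /series /= big_ltn// lerDl sumr_ge0// => i _.
by rewrite ltW// lam0.
Unshelve. all: end_near. Qed.

Section ChainSeries.
Variables (lam : nat -> nat -> R) (n0 : nat) (a : R).
Hypothesis a0 : 0 < a.
Hypothesis rate_gt0 : forall m, 0 < total_rate lam (n0 + m)%N.

Definition chain_term n (x : n.-tuple nat) t k := chain_coef k (chain_rates lam n0 x) * tau a k t.

Lemma cvg_chain_series n (x : n.-tuple nat) t : cvgn (series (chain_term x t)).
Proof.
pose M := \sum_(b <- chain_rates lam n0 x) (`|b| + 1).
have M0 : 0 <= M by rewrite sumr_ge0// => b _; rewrite addr_ge0.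
rewrite /chain_term.
apply: (@cvg_tau_series _ a t M (fun k => chain_coef k (chain_rates lam n0 x)) a0 M0) => k.
apply: chain_coef_bound => // b bs.
by rewrite /M (big_rem b)//= lerDl sumr_ge0// => c _; rewrite addr_ge0.
Qed.

Lemma size_chain_rates n (x : n.-tuple nat) : size (chain_rates lam n0 x) = nstar x.
Proof. by rewrite size_map size_rev. Qed.

Lemma mu_chain_rates n (x : n.-tuple nat) (l : 'I_(nstar x)) :
  mu lam n0 l = nth 0 (rev (chain_rates lam n0 x)) l.
Proof. by rewrite /chain_rates map_rev revK (nth_map 0%N). Qed.

Lemma series_term_chain n (x : n.-tuple nat) t i :
  (-1) ^+ (nstar x - 1) / (\prod_(l < nstar x | (0 < l)%N) mu lam n0 l) *
    series_term lam n0 x a t i = chain_term x t i.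
Proof.
rewrite /chain_term -(@Omega_chain_coef _ (nstar x) i (chain_rates lam n0 x)
  (fun l => mu lam n0 l)).
- have regroup (u v w e f : R) : u * (e * f / w * v) = u * (e * v) * (f / w) by ring.
  by rewrite /series_term /tau [(- (t `^ a)) ^+ i]exprNn; exact: regroup.
- exact: size_chain_rates.
- exact: chain_rates_neq0.
- exact: mu_chain_rates.
- by apply/allP => b /mapP[j _ ->]; rewrite gt_eqF.
Qed.

(** The terms of index i < n* - 1, absent from the series of the statement,
vanish. *)
Lemma series_term_partial n (x : n.-tuple nat) t :
  series (chain_term x t) =
  (fun N => (-1) ^+ (nstar x - 1) / (\prod_(l < nstar x | (0 < l)%N) mu lam n0 l) *
    \sum_(nstar x - 1 <= i < N) series_term lam n0 x a t i).
Proof.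
apply/funext => N; rewrite mulr_sumr /series /=.
under [RHS]eq_bigr do rewrite series_term_chain.
have small i : (i < nstar x - 1)%N -> chain_term x t i = 0.
  move=> ix; rewrite /chain_term chain_coef_small ?mul0r// size_chain_rates.
  by lia.
have zeros K : (K <= nstar x - 1)%N -> \sum_(0 <= i < K) chain_term x t i = 0.
  by move=> Kx; rewrite big_nat big1// => i /andP[_ iK]; exact: small (leq_trans iK Kx).
have [xN|/ltnW Nx] := leqP (nstar x - 1) N; last by rewrite zeros// big_geq.
by rewrite (big_cat_nat _ xN)//= zeros// add0r.
Qed.

Lemma series_prefactor_neq0 n (x : n.-tuple nat) :
  (-1) ^+ (nstar x - 1) / (\prod_(l < nstar x | (0 < l)%N) mu lam n0 l) != 0.
Proof.
rewrite mulf_neq0 ?signr_eq0// invr_eq0; apply/prodf_neq0 => l _.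
by rewrite /mu gt_eqF.
Qed.

Lemma cvg_series_term n (x : n.-tuple nat) t :
  cvgn (fun N => \sum_(nstar x - 1 <= i < N) series_term lam n0 x a t i).
Proof.
have := @cvg_chain_series n x t; rewrite series_term_partial => cv.
by move: cv; rewrite is_cvgMrE// series_prefactor_neq0.
Qed.

Lemma lim_chain_series n (x : n.-tuple nat) t :
  limn (series (chain_term x t)) =
  (-1) ^+ (nstar x - 1) / (\prod_(l < nstar x | (0 < l)%N) mu lam n0 l) *
    limn (fun N => \sum_(nstar x - 1 <= i < N) series_term lam n0 x a t i).
Proof.
rewrite series_term_partial; apply/cvg_lim => //.
by apply: cvgM; [exact: cvg_cst|exact: cvg_series_term].
Qed.

Lemma lim_chain_series_distinct n (x : n.-tuple nat) t :
  injective (fun l : 'I_(nstar x) => mu lam n0 l) ->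
  limn (series (chain_term x t)) =
  \sum_(i < nstar x)
    (mittag_leffler a (- (mu lam n0 i * t `^ a)) /
      \prod_(l < nstar x | l != i) (mu lam n0 l - mu lam n0 i)).
Proof.
move=> mu_inj; pose v (l : 'I_(nstar x)) : R := mu lam n0 l.
have ratesE : perm_eq (chain_rates lam n0 x) [seq v l | l <- enum 'I_(nstar x)].
  rewrite /chain_rates map_rev perm_rev.
  rewrite [X in perm_eq X _](_ : _ = [seq v l | l <- enum 'I_(nstar x)]) //.
  apply: (@eq_from_nth _ 0); first by rewrite size_map [RHS]size_map size_enum_ord.
  move=> j; rewrite size_map => jx.
  rewrite (nth_map 0%N)// (nth_map (Ordinal jx)) ?size_enum_ord//.
  by rewrite /v /mu nth_enum_ord.
have us : uniq (chain_rates lam n0 x).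
  by rewrite (perm_uniq ratesE) map_inj_uniq ?enum_uniq.
have vdmE i : vdm (chain_rates lam n0 x) (v i) = \prod_(l < nstar x | l != i) (v l - v i).
  rewrite /vdm (perm_big _ ratesE) /= big_map big_enum_cond /=.
  by apply: eq_bigl => l; rewrite (inj_eq mu_inj).
have -> : chain_term x t = fun k => \sum_(i <- enum 'I_(nstar x))
    (\prod_(l < nstar x | l != i) (v l - v i))^-1 * ((- v i) ^+ k * tau a k t).
  apply/funext => k; rewrite /chain_term chain_coef_distinct// (perm_big _ ratesE) /=.
  rewrite big_map mulr_suml; apply: eq_bigr => i _.
  by rewrite vdmE mulrAC mulrC.
apply/cvg_lim => //; rewrite -big_enum /=.
under [X in _ --> X]eq_bigr do rewrite mittag_leffler_tau mulrC.
apply: cvg_series_sum => i.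
apply: (@cvg_tau_series _ a t `|v i| (fun k => (- v i) ^+ k) a0) => // k.
by rewrite normrX normrN.
Qed.

End ChainSeries.
End StateProbabilities.

Theorem mainTheorem6 (R : realType) (d : measure_display)
  (T : measurableType d) (P : probability T R) (X : R -> T -> \bar R)
  (n0 : nat) (alpha : R) (lam : nat -> nat -> R)
  (alpha_range : 0 < alpha <= 1)
  (lam_gt0 : forall n i : nat, (n0 <= n)%N -> (1 <= i)%N -> 0 < lam n i)
  (lam_summable : forall n : nat, (n0 <= n)%N ->
     cvgn (series (fun i : nat => lam n i.+1)))
  (lam_conv : forall n : nat, (n0 <= n)%N -> lam n 0%N = 1)
  (X_measurable : forall t : R, 0 <= t -> measurable_fun setT (X t))
  (p_below : forall (n : nat) (t : R), (n < n0)%N -> 0 <= t ->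
     state_prob P X n t = 0)
  (p_cont0 : forall n : nat, (n0 <= n)%N ->
     state_prob P X n s @[s --> 0^'+] --> state_prob P X n 0)
  (p_caputo : forall (n : nat) (t : R), (n0 <= n)%N -> 0 < t ->
     caputo_derivable alpha (state_prob P X n) t)
  (p_eq : forall (n : nat) (t : R), (n0 <= n)%N -> 0 < t ->
     caputo alpha (state_prob P X n) t =
       - (total_rate lam n * state_prob P X n t)
       + \sum_(1 <= i < n.+1) lam (n - i)%N i * state_prob P X (n - i)%N t)
  (p_init : state_prob P X n0 0 = 1)
  (p_init0 : forall n : nat, (n0 < n)%N -> state_prob P X n 0 = 0) :
  (forall t : R, 0 <= t ->
     state_prob P X n0 t =
       mittag_leffler alpha (- (total_rate lam n0 * t `^ alpha))) /\
  (forall m : nat, (1 <= m)%N ->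
     (forall t : R, 0 <= t ->
        (forall x : m.-tuple nat, x \in Theta m m ->
           cvgn (fun N : nat =>
             \sum_(nstar x - 1 <= i < N) series_term lam n0 x alpha t i)) /\
        state_prob P X (n0 + m)%N t =
          \sum_(x <- Theta m m)
            (\prod_(j < m) lam (n0 + j)%N (tnth x j)) *
            ((-1) ^+ (nstar x - 1) /
               \prod_(l < nstar x | (0 < l)%N) mu lam n0 l) *
            limn (fun N : nat =>
              \sum_(nstar x - 1 <= i < N) series_term lam n0 x alpha t i)) /\
     ((forall x : m.-tuple nat, x \in Theta m m ->
         injective (fun l : 'I_(nstar x) => mu lam n0 l)) ->
      forall t : R, 0 <= t ->
        state_prob P X (n0 + m)%N t =
          \sum_(x <- Theta m m)
            (\prod_(j < m) lam (n0 + j)%N (tnth x j)) *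
            \sum_(i < nstar x)
              (mittag_leffler alpha (- (mu lam n0 i * t `^ alpha)) /
                 \prod_(l < nstar x | l != i) (mu lam n0 l - mu lam n0 i)))).
Proof.
have /andP[a0 a1] := alpha_range.
pose p m t := state_prob P X (n0 + m) t.
have rate_gt0 m : 0 < total_rate lam (n0 + m)%N.
  apply: total_rate_gt0; last by apply: lam_summable; rewrite leq_addr.
  by move=> i; apply: lam_gt0; rewrite leq_addr.
have p_bound (m : nat) (t : R) : 0 <= t -> `|p m t| <= 1.
  by move=> t0; apply: state_prob_norm_le1; exact: X_measurable.
have p_init_all m : p m 0 = (m == 0%N)%:R.
  rewrite /p; case: m => [|m]; first by rewrite addn0 p_init.
  by rewrite p_init0// -addSnnS leq_addr.
pose rhs m s := - (total_rate lam (n0 + m)%N * p m s) +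
  \sum_(1 <= i < m.+1) lam (n0 + (m - i))%N i * p (m - i)%N s.
have p_rhs (m : nat) (t : R) : 0 < t -> caputo alpha (p m) t = rhs m t.
  move=> t0; rewrite p_eq ?leq_addr// /rhs; congr (_ + _).
  (* The jumps i > m would start from states below n0. *)
  rewrite (@big_cat_nat _ _ _ m.+1)//=; last by rewrite ltnS leq_addl.
  rewrite [X in _ + X]big_nat [X in _ + X]big1 ?addr0 => [|i /andP[mi iN]]; last first.
    by rewrite p_below ?mulr0 ?(ltW t0)//; lia.
  by apply: eq_big_nat => i /andP[i0 im]; rewrite /p addnBA.
have p_der m : forall t : R, 0 < t -> caputo_derivable alpha (p m) t.
  by move=> t t0; apply: p_caputo => //; rewrite leq_addr.
have p_cont m : p m s @[s --> 0^'+] --> p m 0.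
  by apply: p_cont0; rewrite leq_addr.
have p_meas (m : nat) (t : R) : measurable_fun `]0, t[ (p m).
  by apply: measurable_derivable_oo; exact: derivable_of_caputo (p_der m).
have p_abel (m : nat) (t : R) : 0 < t -> abel_integral alpha t (rhs m) (Gamma alpha * (p m t - p m 0)).
  move=> t0; apply: caputo_volterra => //; first exact: p_der.
    by move=> s s0; exact: p_rhs.
  apply: (@integrable_bounded_oo _ _ _ (`|total_rate lam (n0 + m)%N| +
      \sum_(1 <= i < m.+1) `|lam (n0 + (m - i))%N i|)).
    apply: measurable_funD.
      by apply: measurableT_comp => //; apply: measurable_funM.
    by apply: measurable_sum => i; apply: measurable_funM.
  move=> s; rewrite in_itv /= => /andP[/ltW s0 _].
  rewrite (le_trans (ler_normD _ _))// normrN lerD//.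
    by rewrite normrM ler_piMr// p_bound.
  rewrite (le_trans (ler_norm_sum _ _ _))// ler_sum// => i _.
  by rewrite normrM ler_piMr// p_bound.
have p_series (m : nat) (t : R) : 0 <= t ->
    p m t = limn (series (fun k => taylor lam n0 k m * tau alpha k t)).
  move=> t0; apply/esym/cvg_lim => //.
  exact: (cvg_taylor_series a0 p_bound p_init_all p_abel).
have p_Theta (m : nat) (t : R) : (0 < m)%N -> 0 <= t -> p m t =
    \sum_(x <- Theta m m) weight lam n0 x * limn (series (chain_term lam n0 alpha x t)).
  move=> m0 t0; rewrite p_series//; apply/cvg_lim => //.
  have -> : (fun k => taylor lam n0 k m * tau alpha k t) =
     (fun k => \sum_(x <- Theta m m) weight lam n0 x * chain_term lam n0 alpha x t k).
    apply/funext => k; rewrite taylor_Theta// mulr_suml.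
    by apply: eq_bigr => x _; rewrite /chain_term mulrA.
  apply: cvg_series_sum => x; exact: cvg_chain_series.
split.
  move=> t t0; have := p_series 0%N t t0; rewrite /p addn0 mittag_leffler_tau => ->.
  congr (limn (series _)); apply/funext => k.
  by rewrite taylor_0 addn0.
move=> m m0; split.
  move=> t t0; split; first by move=> x _; exact: cvg_series_term.
  rewrite -/(p m t) p_Theta//; apply: eq_bigr => x _.
  by rewrite lim_chain_series// mulrA.
move=> mu_inj t t0; rewrite -/(p m t) p_Theta//; apply: eq_big_seq => x xT.
by rewrite lim_chain_series_distinct//; exact: mu_inj.
Qed.
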